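(* Let $\epsilon>0$. For almost every rotation class interval exchange transformation $T$ (that is, for every irreducible permutation $\pi$ of rotation class and Lebesgue-almost every $\lambda\in\mathbb{P}_+^{d-1}$, with $T=T_{\lambda,\pi}$) there exists a constant $c_2=c_2(T)>0$ such that for every integer $N\ge3$ there exist Lipschitz functions $f$ and $g$ on $I=[0,1)$, not identically zero and depending on $N$, such that $$Q_N(f,g)\ \ge\ c_2\,\frac{N\,\|f\|_L^2\,\|g\|_L^2}{\left(\log N\,(\log\log N)^{1+\epsilon}\right)^{9}},$$ where $$Q_N(f,g):=\sum_{n=0}^{N-1}\left|\int_I f\circ T^n(y)\,g(y)\,dy-\int_I f\int_I g\right|^2 .$$
   Context: Interval exchange transformations (IETs). Let $\mathcal A$ be an alphabet with $d>1$ letters. A permutation on $d$ symbols is a pair $\pi=(\pi_t,\pi_b)$ of bijections $\mathcal A\to\{1,\dots,d\}$; it is irreducible if there is no $1\le k<d$ with $\pi_t^{-1}(\{1,\dots,k\})=\pi_b^{-1}(\{1,\dots,k\})$. $\mathbb{P}_+^{d-1}$ is the projectivization of $\mathbb{R}_+^{d}$ (vectors with positive entries), identified with $\{\lambda\in\mathbb{R}_+^{\mathcal A}:\sum_\alpha\lambda_\alpha=1\}$. For such $\lambda$, the interval $I=[0,1)$ is partitioned into intervals $I_\alpha$, closed on the left and open on the right, of length $\lambda_\alpha$, placed from left to right in the order $\pi_t^{-1}(1),\dots,\pi_t^{-1}(d)$; $T_{\lambda,\pi}:I\to I$ translates each $I_\alpha$ so that the images appear from left to right in the order $\pi_b^{-1}(1),\dots,\pi_b^{-1}(d)$.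 Rauzy classes. Let $\alpha_t,\alpha_b$ be the letters with $\pi_t(\alpha_t)=\pi_b(\alpha_b)=d$. The top Rauzy operation keeps $\pi_t$ and modifies the bottom order by moving $\alpha_b$ to the position immediately after $\alpha_t$; the bottom Rauzy operation keeps $\pi_b$ and modifies the top order by moving $\alpha_t$ to the position immediately after $\alpha_b$. These operations generate an equivalence relation on irreducible permutations, whose classes are the Rauzy classes. A permutation is a rotation if $\pi_b\circ\pi_t^{-1}$ preserves the cyclic order of $\{1,\dots,d\}$ (i.e. it is $i\mapsto i+c \bmod d$ for some $c$). An irreducible permutation is of rotation class if its Rauzy class contains a rotation. Norm. For a Lipschitz $f$, $\|f\|_L=\|f\|_\infty+\mathrm{Lip}(f)$, where $\mathrm{Lip}(f)$ is the best Lipschitz constant. *)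

(* Defs.v *)
From HB Require Import structures.
From Stdlib Require Import Relation_Operators.
From mathcomp Require Import all_boot all_order all_algebra.
From mathcomp Require Import all_classical all_reals all_analysis.
Import Order.TTheory GRing.Theory Num.Theory.
Import numFieldNormedType.Exports.

Set Implicit Arguments.
Unset Strict Implicit.
Unset Printing Implicit Defensive.

Local Open Scope classical_set_scope.
Local Open Scope ring_scope.

(* Positions are numbered from 0: the position called k in {1, ..., d} is k - 1
   here. *)
Record iet_perm (A : finType) := IetPerm {
  top_pos : A -> 'I_#|A|;
  bot_pos : A -> 'I_#|A|;
  top_pos_bij : bijective top_pos;
  bot_pos_bij : bijective bot_pos }.

Section Rauzy.
Variable A : finType.
Implicit Types p q : iet_perm A.

Definition irreducible p : Prop :=
  forall k : nat, (0 < k < #|A|)%N ->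
    [set a | (top_pos p a < k)%N] <> [set a | (bot_pos p a < k)%N].

Definition is_last (pos : A -> 'I_#|A|) (a : A) : Prop :=
  pos a = #|A|.-1 :> nat.

(* The position of b after the last letter l of the row pos has been moved
   immediately after the letter a. *)
Definition move_after (pos : A -> 'I_#|A|) (a l b : A) : nat :=
  if b == l then (pos a).+1
  else if (pos b <= pos a)%N then pos b : nat else (pos b).+1.

(* In the next two relations t and b are the last letters of the top and bottom
   rows of p. *)
Definition rauzy_top p q : Prop :=
  exists t b : A, [/\ is_last (top_pos p) t, is_last (bot_pos p) b,
    forall x, top_pos q x = top_pos p x &
    forall x, bot_pos q x = move_after (bot_pos p) t b x :> nat].

Definition rauzy_bot p q : Prop :=
  exists t b : A, [/\ is_last (top_pos p) t, is_last (bot_pos p) b,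
    forall x, bot_pos q x = bot_pos p x &
    forall x, top_pos q x = move_after (top_pos p) b t x :> nat].

Definition rauzy_step p q : Prop :=
  [/\ irreducible p, irreducible q & rauzy_top p q \/ rauzy_bot p q].

Definition rauzy_equiv : iet_perm A -> iet_perm A -> Prop :=
  clos_refl_sym_trans (iet_perm A) rauzy_step.

Definition rotation p : Prop :=
  exists c : nat,
    forall a, bot_pos p a = ((top_pos p a + c) %% #|A|)%N :> nat.

Definition rotation_class p : Prop :=
  irreducible p /\ exists q, rauzy_equiv p q /\ rotation q.

End Rauzy.

Section Transformation.
Context {R : realType} {A : finType}.
Variables (p : iet_perm A) (lam : A -> R).

Definition left_end (pos : A -> 'I_#|A|) (a : A) : R :=
  \sum_(b | (pos b < pos a)%N) lam b.

Definition in_piece (a : A) (x : R) : bool :=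
  left_end (top_pos p) a <= x < left_end (top_pos p) a + lam a.

(* When lam is a point of the simplex, the pieces partition [0, 1): on [0, 1)
   the letter picked is then the only one, and the default value is unused. *)
Definition iet (x : R) : R :=
  if [pick a | in_piece a x] is Some a
  then x - left_end (top_pos p) a + left_end (bot_pos p) a else x.

End Transformation.

Section LebesgueTuple.
Variable R : realType.
Local Open Scope ereal_scope.
Local Notation mR := (measurableTypeR R).

Definition tcons n (x : mR * n.-tuple mR) : n.+1.-tuple mR :=
  [tuple of x.1 :: x.2].

Lemma measurable_tcons n : measurable_fun setT (@tcons n).
Proof. exact: measurable_cons. Qed.

Definition tuncons n (t : n.+1.-tuple mR) : mR * n.-tuple mR :=
  (thead t, [tuple of behead t]).

Lemma measurable_tuncons n : measurable_fun setT (@tuncons n).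
Proof.
apply: measurable_fun_pair; first exact: measurable_tnth.
exact: measurable_behead.
Qed.

Lemma tconsK n : cancel (@tcons n) (@tuncons n).
Proof. by case=> x t; rewrite /tuncons theadE; congr (_, _); apply: val_inj. Qed.

Section Succ.
Variables (n : nat) (mu : {sigma_finite_measure set (n.-tuple mR) -> \bar R}).

Definition leb_succ : set (n.+1.-tuple mR) -> \bar R :=
  pushforward (@lebesgue_measure R \x mu) (@tcons n).

Let leb_succ0 : leb_succ set0 = 0.
Proof. by rewrite /leb_succ /pushforward preimage_set0 measure0. Qed.

Let leb_succ_ge0 B : 0 <= leb_succ B.
Proof. exact: (measure_ge0 (@lebesgue_measure R \x mu)). Qed.

Let leb_succ_sigma_additive : semi_sigma_additive leb_succ.
Proof.
have mc := @measurable_tcons n.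
move=> F mF tF mUF; rewrite /leb_succ /pushforward preimage_bigcup.
apply: measure_semi_sigma_additive.
- by move=> k; rewrite -[X in measurable X]setTI; exact: mc.
- apply/trivIsetP => /= i j _ _ ij; rewrite -preimage_setI.
  by move/trivIsetP : tF => /(_ _ _ _ _ ij) ->//; rewrite preimage_set0.
- by rewrite -preimage_bigcup -[X in measurable X]setTI; exact: mc.
Qed.

HB.instance Definition _ := isMeasure.Build _ _ _ leb_succ
  leb_succ0 leb_succ_ge0 leb_succ_sigma_additive.

Let leb_succ_sigma_finite : sigma_finite setT leb_succ.
Proof.
have /sigma_finiteP[F [TF ndF Foo]] := sigma_finiteT (@lebesgue_measure R).
have /sigma_finiteP[G [TG ndG Goo]] := sigma_finiteT mu.
have mFG k : measurable (F k `*` G k).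
  by apply: measurableX; [have [] := Foo k | have [] := Goo k].
exists (fun k => @tuncons n @^-1` (F k `*` G k)).
  apply/seteqP; split=> // t _.
  have [i _ Fi] : (\bigcup_k F k) (thead t) by rewrite -TF.
  have [j _ Gj] : (\bigcup_k G k) [tuple of behead t] by rewrite -TG.
  exists (maxn i j) => //; split => /=.
    by move: Fi; apply/subsetPset/ndF/leq_maxl.
  by move: Gj; apply/subsetPset/ndG/leq_maxr.
move=> k; split.
  by rewrite -[X in measurable X]setTI; exact: measurable_tuncons.
rewrite /leb_succ /pushforward -comp_preimage (_ : _ \o _ = id); last first.
  by apply/funext => x; exact: tconsK.
have [? ?] := Foo k; have [? ?] := Goo k.
by rewrite preimage_id product_measure1E// lte_mul_pinfty// ge0_fin_numE.
Qed.

HB.instance Definition _ := Measure_isSigmaFinite.Build _ _ _ leb_succ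
  leb_succ_sigma_finite.

End Succ.

(* Lebesgue measure on R^n, as an iterated product *)
Fixpoint leb n : {sigma_finite_measure set (n.-tuple mR) -> \bar R} :=
  if n is m.+1 then leb_succ (leb m) else \d_([tuple] : 0.-tuple mR).

End LebesgueTuple.

Section Simplex.
Context {R : realType} {A : finType}.

Definition simplex (lam : A -> R) : Prop :=
  (forall a, 0 < lam a) /\ \sum_a lam a = 1.

(* The affine chart of the hyperplane of vectors with coordinate sum 1 that
   omits the coordinate of the last letter in the enumeration of A. *)
Definition simplex_chart (t : #|A|.-1.-tuple R) (a : A) : R :=
  if (enum_rank a < #|A|.-1)%N then nth 0 t (enum_rank a)
  else 1 - \sum_(x <- t) x.

(* The Lebesgue measure of the simplex is, up to a constant factor, the image of
   that of R^(d-1) under the chart. Omitting another coordinate amounts to an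
   affine change of variables of determinant 1 or -1, and so does not change
   the notion. *)
Definition ae_simplex (P : (A -> R) -> Prop) : Prop :=
  {ae leb R #|A|.-1, forall t : #|A|.-1.-tuple R,
    simplex (simplex_chart t) -> P (simplex_chart t)}.

End Simplex.

Section Correlations.
Context {R : realType}.
Implicit Types f g T : R -> R.

Definition unit_co : set R := `[0, 1[%classic.

Definition sup_norm f : R := sup [set `|f x| | x in unit_co].

Definition best_lip f : R :=
  inf [set k : R | 0 <= k /\ k.-lipschitz_unit_co (f : R^o -> R^o)].

Definition lip_norm f : R := sup_norm f + best_lip f.

Definition integral_co f : R := \int[lebesgue_measure]_(y in unit_co) f y.

Definition corr_sum T (N : nat) f g : R :=
  \sum_(n < N)
    `|integral_co (fun y => f (iter n T y) * g y)
      - integral_co f * integral_co g| ^+ 2.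

End Correlations.

(* Main.v *)
Require Import Defs.
From Stdlib Require Import Relation_Operators.
From mathcomp Require Import all_boot all_order all_algebra all_fingroup.
From mathcomp Require Import all_classical all_reals all_analysis measurable_realfun.
From mathcomp Require Import zify ring lra.
Import Order.TTheory GRing.Theory Num.Theory.
Import numFieldNormedType.Exports.
Local Open Scope classical_set_scope.
Local Open Scope ring_scope.

Set Implicit Arguments.
Unset Strict Implicit.
Unset Printing Implicit Defensive.

(* The translation matrix of a rotation class permutation has rank two: it is
   u_a v_b - v_a u_b for integer vectors u >= 1 and v, because this holds for
   rotations and is carried along by Rauzy moves. With U = <u, lambda> and
   V = <v, lambda>, T translates the piece of a by u_a V - v_a U. So T^n x is
   x + h V modulo U, where h is the Birkhoff sum over n steps of the return time
   u_a, and the orbit of x gives n visits to [0, 1) of the rotation by V of the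
   circle of length U within time h. By the Denjoy-Koksma inequality the number of
   visits is at most h / U plus a discrepancy that, for almost every lambda, is
   O((log N)^(3/2)); hence h >= n U - M with M = O((log N)^(3/2)). The mean of h is
   n U, so by Markov's inequality h is within O(M) of n U outside a set of measure
   1/32.

   Cut [0, 1) into L cells with L a large multiple of M. Up to that small set, the
   points of a cell land after time n in O(M) cells, so for most pairs of cells
   the tent functions on them have a correlation far below the product of their
   means. The sum over all pairs of the squared deviations is therefore of order
   L^(-6), and choosing signs for the tents one at a time produces f and g whose
   deviation, squared and summed over n < N, is of order N L^(-6), that is,
   N / (log N)^9. *)

(** * Rotation class permutations *)

Section WedgeForm.
Variable A : finType.
Implicit Types (p q : iet_perm A) (pos top bot : A -> 'I_#|A|).

(** The antisymmetric translation matrix of the exchange: the piece of [a] moves by the sum over [b]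
    of [omega top bot a b] times the length of [b]. *)
Definition omega top bot (a b : A) : int :=
  ((bot b < bot a)%N : nat)%:Z - ((top b < top a)%N : nat)%:Z.

(** Rank two for [omega]. The positivity of [u] is what later allows its entries to serve as return
    times. *)
Definition wedge_form top bot (u v : A -> int) : Prop :=
  (forall a, 1 <= u a) /\
  forall a b, omega top bot a b = u a * v b - v a * u b.

(** The move replaces row [b] of [omega] by the sum of rows [b] and [t], and likewise for columns.
    The same substitution in [u] and [v] preserves the wedge form, and being additive it keeps [u]
    positive. *)
Lemma move_after_wedge pos pos' oth (t b : A) (u v : A -> int) :
  injective pos -> injective oth ->
  is_last oth t -> is_last pos b ->
  (forall x, pos' x = move_after pos t b x :> nat) ->
  wedge_form oth pos u v ->
  wedge_form oth pos' (fun x => if x == b then u b + u t else u x)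
                      (fun x => if x == b then v b + v t else v x).
Proof.
move=> ip io lt lb posE [u1 w]; split=> [a|x y].
  by case: eqP => _; [have := u1 b; have := u1 t; lia | exact: u1].
have nposE z : (pos' z : nat) = if z == b then (pos t).+1 else
    if (pos z <= pos t)%N then pos z : nat else (pos z).+1 by exact: posE.
(* If [t] and [b] coincided, the moved letter would get position [#|A|], which is out of range. *)
have tb : t != b.
  apply/eqP => tb; have := nposE t; rewrite tb eqxx => e.
  by have := ltn_ord (pos' b); have := ltn_ord (pos b); rewrite e lb; lia.
have lastp z : (pos z <= pos b)%N by rewrite lb; have := ltn_ord (pos z); lia.
have lasto z : (oth z <= oth t)%N by rewrite lt; have := ltn_ord (oth z); lia.
have ipn z z' : z != z' -> (pos z : nat) <> pos z'.
  by move=> /eqP zz' /val_inj/ip.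
have ion z z' : z != z' -> (oth z : nat) <> oth z'.
  by move=> /eqP zz' /val_inj/io.
have wN z z' : u z * v z' - v z * u z' = omega oth pos z z' by rewrite w.
have -> : (if x == b then u b + u t else u x) * (if y == b then v b + v t else v y)
   - (if x == b then v b + v t else v x) * (if y == b then u b + u t else u y)
  = if x == b then if y == b then 0 else omega oth pos b y + omega oth pos t y
    else if y == b then omega oth pos x b + omega oth pos x t
    else omega oth pos x y.
  by case: (eqVneq x b); case: (eqVneq y b) => *; rewrite ?w; ring.
rewrite /omega !nposE.
have := lastp x; have := lastp y; have := lastp t.
have := lasto x; have := lasto y; have := lasto b.
have := ipn _ _ tb; have := ion _ _ tb.
have [->|xb] := eqVneq x b; have [->|yb] := eqVneq y b.
- lia.
- have := ipn _ _ yb; have := ion _ _ yb.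
  have [->|yt] := eqVneq y t; first by rewrite !leqnn /=; lia.
  have := ipn _ _ yt; have := ion _ _ yt.
  by case: (leqP (pos y) (pos t)); lia.
- have := ipn _ _ xb; have := ion _ _ xb.
  have [->|xt] := eqVneq x t; first by rewrite !leqnn /=; lia.
  have := ipn _ _ xt; have := ion _ _ xt.
  by case: (leqP (pos x) (pos t)); lia.
- have := ipn _ _ xb; have := ion _ _ xb.
  have := ipn _ _ yb; have := ion _ _ yb.
  by case: (leqP (pos x) (pos t)); case: (leqP (pos y) (pos t)); lia.
Qed.

Definition has_wedge top bot := exists u v, wedge_form top bot u v.

(** Exchanging the rows negates [omega], which is absorbed by the sign of [v] and leaves [u]
    positive. Bottom moves thus reduce to top moves. *)
Lemma has_wedge_sym top bot : has_wedge top bot -> has_wedge bot top.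
Proof.
move=> [u [v [u1 w]]]; exists u, (fun x => - v x); split=> // a b.
have := w a b; rewrite /omega => e.
rewrite mulrN mulNr opprK.
have -> : - (u a * v b) + v a * u b = - (u a * v b - v a * u b) by ring.
by rewrite -e; ring.
Qed.

(* The move permutes the positions by a cycle that depends only on the position
   of t, so a power of the move is its inverse. *)
Lemma move_after_wedgeV pos pos' oth (t b : A) :
  bijective pos -> injective pos' -> injective oth ->
  is_last oth t -> is_last pos b ->
  (forall x, pos' x = move_after pos t b x :> nat) ->
  has_wedge oth pos' -> has_wedge oth pos.
Proof.
move=> bp ip' io lt lb posE.
have ip := bij_inj bp; case: (bp) => g pK gK.
have ig : injective (pos' \o g) by apply: inj_comp => //; exact: can_inj gK.
pose s := perm ig.
have sE i : (s i : nat) = if i == pos b then (pos t).+1 else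
   if (i <= pos t)%N then i : nat else i.+1.
  rewrite permE /= posE /move_after gK.
  by rewrite -[in i == _](gK i) (inj_eq ip).
have spos x : pos' x = s (pos x) by rewrite permE /= pK.
have tb : t != b.
  apply/eqP => tb; have := sE (pos t); rewrite tb eqxx => e.
  by have := ltn_ord (s (pos b)); have := ltn_ord (pos b); rewrite e lb; lia.
have ptb : (pos t < pos b)%N.
  have : (pos t : nat) <> pos b by move=> /val_inj/ip/eqP; apply/negP.
  by rewrite lb; have := ltn_ord (pos t); lia.
have stt : s (pos t) = pos t.
  by apply: val_inj; rewrite /= sE leqnn; case: eqP => // /ip/eqP; rewrite (negPf tb).
have sktt k : (s ^+ k)%g (pos t) = pos t.
  elim: k => [|k IH]; first by rewrite expg0 perm1.
  by rewrite expgS permM stt.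
(* The row obtained after [k] moves still has [t] at its old position, so one more move is again the
   permutation [s] of positions, applied to the current last letter [bk]. *)
have step k : has_wedge oth ((s ^+ k)%g \o pos) -> has_wedge oth ((s ^+ k.+1)%g \o pos).
  move=> [u [v w]].
  set pk := (s ^+ k)%g \o pos in w *.
  have gpk : cancel (g \o (s ^+ k)^-1%g) pk by move=> i; rewrite /pk /= gK permKV.
  pose bk := g ((s ^+ k)^-1%g (pos b)).
  have pkb : pk bk = pos b by exact: gpk.
  have ipk : injective pk by apply: inj_comp ip; exact: perm_inj.
  do 2 eexists; apply: (@move_after_wedge pk _ oth t bk u v) => //.
    by rewrite /is_last pkb.
  move=> x; rewrite /= expgSr permM /= sE /move_after.
  rewrite -[(s ^+ k)%g (pos x)]/(pk x) -pkb (inj_eq ipk).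
  by rewrite [pk t](sktt k).
move=> w1.
have wk k : has_wedge oth ((s ^+ k.+1)%g \o pos).
  elim: k => [|k IH]; last exact: step.
  by rewrite expg1 (_ : s \o pos = pos') //; apply/funext => x; rewrite /= spos.
(* Iterating up to the order of [s] brings the row back to [pos]. *)
have := wk #[s]%g.-1; rewrite prednK ?order_gt0// expg_order.
by rewrite (_ : (1%g : {perm _}) \o pos = pos) //; apply/funext => x; rewrite /= perm1.
Qed.

Let good p := has_wedge (top_pos p) (bot_pos p).

Lemma rauzy_step_wedge p q : rauzy_step p q -> good p <-> good q.
Proof.
have [tp bp] := (bij_inj (top_pos_bij p), bij_inj (bot_pos_bij p)).
have [tq bq] := (bij_inj (top_pos_bij q), bij_inj (bot_pos_bij q)).
move=> [_ _ [|]] [t [b [lt lb eq1 eq2]]]; rewrite /good.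
- have -> : top_pos q = top_pos p by apply/funext.
  split; last exact: (move_after_wedgeV (bot_pos_bij p) bq tp lt lb eq2).
  by move=> [u [v w]]; do 2 eexists; exact: (move_after_wedge bp tp lt lb eq2 w).
- have -> : bot_pos q = bot_pos p by apply/funext.
  split => /has_wedge_sym w; apply: has_wedge_sym.
  + by case: w => [u [v w]]; do 2 eexists; exact: (move_after_wedge tp bp lb lt eq2 w).
  + exact: (move_after_wedgeV (top_pos_bij p) tq bp lb lt eq2).
Qed.

(** The witness is [u = 1] with [v] the indicator of the letters that wrap around modulo [d]: two
    letters change their relative order exactly when one of them wraps and the other does not. *)
Lemma rotation_wedge p : rotation p -> good p.
Proof.
move=> [c cE]; pose d := #|A|; pose c' := (c %% d)%N.
exists (fun=> 1), (fun a => if (top_pos p a + c' < d)%N then 0 else 1).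
split=> // a b.
have d0 : (0 < d)%N by apply/card_gt0P; exists a.
have c'd : (c' < d)%N by rewrite ltn_mod.
have botE x : bot_pos p x = (if (top_pos p x + c' < d)%N then top_pos p x + c'
    else top_pos p x + c' - d)%N :> nat.
  rewrite cE -/d -modnDmr -/c'; case: ltnP => h; first by rewrite modn_small.
  rewrite -[in LHS](subnK h) modnDr modn_small//.
  by have := ltn_ord (top_pos p x); rewrite -/d; lia.
rewrite /omega !botE.
have := ltn_ord (top_pos p a); have := ltn_ord (top_pos p b); rewrite -/d.
move: (nat_of_ord (top_pos p a)) (nat_of_ord (top_pos p b)) c'd => x y.
move: c' {botE} => e ed.
by case: (ltnP (x + e) d); case: (ltnP (y + e) d); rewrite ?mulr1 ?mulr0 ?mul0r; lia.
Qed.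

Lemma rotation_class_wedge p : rotation_class p -> good p.
Proof.
move=> [_ [q [pq /rotation_wedge]]].
suff -> : good p <-> good q by [].
by elim: pq => [x y /rauzy_step_wedge//|//|x y _ ->//|x y z _ -> _ ->].
Qed.

(** If [omega] vanished, both rows would order the letters alike and share their first letter,
    against irreducibility at [k = 1]. *)
Lemma irreducible_omega p : (1 < #|A|)%N -> irreducible p ->
  exists a b, omega (top_pos p) (bot_pos p) a b != 0.
Proof.
move=> hA irr; apply: contrapT => /forallNP om0.
have omE a b : (bot_pos p b < bot_pos p a)%N = (top_pos p b < top_pos p a)%N.
  have /forallNP/(_ b)/negP/negPn/eqP := om0 a.
  by rewrite /omega; case: (_ < _)%N; case: (_ < _)%N.
have z : (0 < #|A|)%N by lia.
have first pos pos' : bijective pos' ->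
    (forall a b : A, (pos b < pos a)%N = ((pos' b : 'I_#|A|) < pos' a)%N) ->
    forall a, ((pos a : 'I_#|A|) < 1)%N -> (pos' a < 1)%N.
  move=> [g _ gK] e a; rewrite ltnS leqn0 => /eqP a0.
  have := e a (g (Ordinal z)); rewrite a0 ltn0 gK /=.
  by move=> /esym/negbT; rewrite -leqNgt ltnS.
apply: (irr 1%N) => //; apply/seteqP; split=> a /=.
- by apply: first => [|x y]; [exact: bot_pos_bij | rewrite omE].
- by apply: first => [|x y]; [exact: top_pos_bij | rewrite omE].
Qed.

End WedgeForm.

(** * Almost sure Diophantine condition *)

Section LebesgueSlices.
Variable R : realType.
Local Notation mR := (measurableTypeR R).

Definition set_coord n (t : n.-tuple mR) (i : 'I_n) (s : R) : n.-tuple mR :=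
  [tuple if k == i then s else tnth t k | k < n].

(** Fubini, by induction on [n]: [leb] is an iterated product, so for [i = 0] Tonelli integrates
    over the first coordinate first, and otherwise the sections at a fixed first coordinate are null
    by induction. *)
Lemma leb_slice_null n (i : 'I_n) (N : set (n.-tuple mR)) : measurable N ->
  (forall t, (@lebesgue_measure R).-negligible [set s | N (set_coord t i s)]) ->
  leb R n N = 0%E.
Proof.
elim: n i N => [[]//|n IH] i N mN slice0.
have mN' : measurable (@tcons R n @^-1` N).
  by rewrite -[X in measurable X]setTI; exact: measurable_tcons.
change ((@lebesgue_measure R \x leb R n)%E (@tcons R n @^-1` N) = 0%E).
have [i0|i0] := eqVneq i ord0.
  rewrite -[@tcons R n @^-1` N]setIT -integral_indic//.
  rewrite fubini_tonelli2//; last first.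
    by apply/measurable_EFinP; exact: measurable_indic.
  apply: integral0_eq => y _; rewrite /fubini_G /=.
  under eq_integral => x _.
    rewrite (_ : \1_(_ @^-1` N) (x, y) = \1_(ysection (@tcons R n @^-1` N) y) x).
    over.
    by rewrite !indicE mem_ysection.
  rewrite integral_indic ?setIT//; last exact: measurable_ysection.
  apply/negligibleP; first exact: measurable_ysection.
  apply: negligibleS (slice0 (tcons (0, y))) => x; rewrite /ysection/= inE /= i0.
  congr N; apply: eq_from_tnth => k; rewrite tnth_mktuple.
  by case: (unliftP ord0 k) => [l ->|->] //=; rewrite !(tnth_nth 0).
rewrite /product_measure1 /=; apply: integral0_eq => x _ /=.
have [j ij|/eqP] := unliftP ord0 i; last by rewrite (negPf i0).
apply: (IH j); first exact: measurable_xsection.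
move=> t; apply: negligibleS (slice0 (tcons (x, t))) => s.
rewrite /xsection/= inE /=.
congr N; apply: eq_from_tnth => k; rewrite tnth_mktuple ij.
case: (unliftP ord0 k) => [l ->|->] //=.
have tnthS y : tnth (tcons (x, y)) (lift ord0 l) = tnth y l by rewrite !(tnth_nth 0).
by rewrite (inj_eq (@lift_inj _ _)) !tnthS tnth_mktuple.
Qed.

Lemma leb_slice_negligible n (i : 'I_n) (N : set (n.-tuple mR)) : measurable N ->
  (forall t, (@lebesgue_measure R).-negligible [set s | N (set_coord t i s)]) ->
  (leb R n).-negligible N.
Proof. by move=> mN N0; apply/negligibleP => //; exact: leb_slice_null N0. Qed.

End LebesgueSlices.

Section BorelCantelli.
Context d (T : measurableType d) (R : realType) (mu : {measure set T -> \bar R}).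

(** First-moment form of Borel-Cantelli: by monotone convergence the series has integral at most
    [K], hence is finite almost everywhere. *)
Lemma negligible_unbounded_sums (f : nat -> T -> R) (c : nat -> R) (K : R) :
  (forall k, measurable_fun setT (f k)) -> (forall k x, 0 <= f k x) ->
  (forall k, (\int[mu]_x (f k x)%:E <= (c k)%:E)%E) ->
  (forall k, \sum_(j < k) c j <= K) ->
  mu.-negligible [set x | forall C, exists k, C < \sum_(j < k) f j x].
Proof.
move=> mf f0 fc cK.
pose g x := (\sum_(0 <= k <oo) (f k x)%:E)%E.
have mfE k : measurable_fun setT (fun x => (f k x)%:E) by exact/measurable_EFinP.
have mg : measurable_fun setT g.
  by apply: ge0_emeasurable_sum => // k x _ _; rewrite lee_fin.
have gE : (\int[mu]_x g x <= K%:E)%E.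
  rewrite integral_nneseries//; last by move=> n x _; rewrite lee_fin.
  apply: lime_le; first by apply: is_cvg_nneseries => n _ _; apply: integral_ge0 => x _; rewrite lee_fin.
  apply: nearW => k; rewrite big_mkord.
  apply: le_trans (_ : (\sum_(j < k) (c j)%:E <= _)%E); first exact: lee_sum.
  by rewrite sumEFin lee_fin.
have gint : mu.-integrable setT g.
  apply/integrableP; split=> //.
  under eq_integral => x _.
    rewrite gee0_abs; last by apply: nneseries_ge0 => n _ _; rewrite lee_fin.
    over.
  by apply: le_lt_trans gE _; rewrite ltry.
have := integrable_ae measurableT gint.
apply: negligibleS => x /= unb /(_ I) gfin.
have [k] := unb (fine (g x)).
apply/negP; rewrite -leNgt -lee_fin fineK// -sumEFin -(big_mkord xpredT (fun j => (f j x)%:E)).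
by apply: nneseries_lim_ge => n _ ; rewrite lee_fin.
Qed.

Lemma negligible_unbounded_indic_sums (n : nat -> nat) (E : nat -> nat -> set T)
    (w c : nat -> nat -> R) (K : R) :
  (forall j q, measurable (E j q)) -> (forall j q, 0 <= w j q) ->
  (forall j q, (mu (E j q) <= (c j q)%:E)%E) ->
  (forall k, \sum_(j < k) \sum_(q < n j) w j q * c j q <= K) ->
  mu.-negligible [set x | forall C, exists k,
    C < \sum_(j < k) \sum_(q < n j) w j q * \1_(E j q) x].
Proof.
move=> mE w0 Ec cK.
have mwE j q : measurable_fun setT (fun x => w j q * \1_(E j q) x).
  by apply: measurable_funM => //; exact: measurable_indic.
apply: (@negligible_unbounded_sums (fun j x => \sum_(q < n j) w j q * \1_(E j q) x)
  (fun j => \sum_(q < n j) w j q * c j q) K) => //.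
- by move=> j; exact: measurable_sum.
- by move=> j x; apply: sumr_ge0 => q _; rewrite mulr_ge0// indicE.
move=> j; under eq_integral do rewrite -sumEFin.
rewrite ge0_integral_sum//; last 2 first.
- by move=> q; exact/measurable_EFinP.
- by move=> q x _; rewrite lee_fin mulr_ge0// indicE.
rewrite -sumEFin; apply: lee_sum => q _.
under eq_integral do rewrite EFinM.
rewrite ge0_integralZl_EFin//; last first.
  by apply/measurable_EFinP; exact: measurable_indic.
by rewrite integral_indic// setIT EFinM lee_wpmul2l// lee_fin.
Qed.

End BorelCantelli.

(** * Fourth and eighth roots, and power sums *)

Section Roots.
Variable R : realType.

(** With these two roots, the exponents 3/4, 9/8 and 3/2 become the integer powers [rt4 x ^+ 3],
    [rt8 x ^+ 9] and [rt8 x ^+ 12]. *)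
Definition rt4 (x : R) := Num.sqrt (Num.sqrt x).
Definition rt8 (x : R) := Num.sqrt (rt4 x).

Lemma rt4_ge0 x : 0 <= rt4 x. Proof. exact: sqrtr_ge0. Qed.
Lemma rt8_ge0 x : 0 <= rt8 x. Proof. exact: sqrtr_ge0. Qed.

Lemma rt4K x : 0 <= x -> rt4 x ^+ 4 = x.
Proof. by move=> x0; rewrite (exprM _ 2 2) !sqr_sqrtr// sqrtr_ge0. Qed.

Lemma rt8K x : 0 <= x -> rt8 x ^+ 8 = x.
Proof. by move=> x0; rewrite (exprM _ 2 4) sqr_sqrtr ?rt4_ge0// rt4K. Qed.

Lemma rt4_gt0 x : 0 < x -> 0 < rt4 x.
Proof. by move=> x0; rewrite !sqrtr_gt0. Qed.

Lemma rt8_gt0 x : 0 < x -> 0 < rt8 x.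
Proof. by move=> x0; rewrite sqrtr_gt0 rt4_gt0. Qed.

Lemma ler_rt4 x y : x <= y -> rt4 x <= rt4 y.
Proof. by move=> xy; rewrite !ler_wsqrtr. Qed.

Lemma ler_rt8 x y : x <= y -> rt8 x <= rt8 y.
Proof. by move=> xy; rewrite ler_wsqrtr ?ler_rt4. Qed.

Lemma rt4M x y : 0 <= x -> rt4 (x * y) = rt4 x * rt4 y.
Proof. by move=> x0; rewrite /rt4 !sqrtrM// sqrtr_ge0. Qed.

(** A mean value inequality, from the factorization of a difference of powers. It replaces integral
    comparison in the power sums below. *)
Lemma expr_sub_le (a b : R) (n : nat) : 0 <= b <= a ->
  a ^+ n.+1 - b ^+ n.+1 <= n.+1%:R * (a - b) * a ^+ n.
Proof.
move=> /andP[b0 ba]; rewrite subrXX [n.+1%:R * _]mulrC -mulrA.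
rewrite ler_wpM2l ?subr_ge0//.
apply: le_trans (_ : \sum_(i < n.+1) a ^+ n <= _); last first.
  by rewrite sumr_const card_ord mulr_natl.
apply: ler_sum => -[i ni] _ /=.
rewrite -[in leRHS](subnK (ni : (i <= n)%N)) exprD.
have a0 := le_trans b0 ba.
by rewrite ler_wpM2l ?exprn_ge0// lerXn2r ?nnegrE.
Qed.

(** The term with exponent -3/4 is at most 4 times the increment of the fourth root, and the
    increments telescope. *)
Lemma sum_rt4_inv3 (Q : nat) : \sum_(q < Q) (rt4 q.+1%:R ^+ 3)^-1 <= 4 * rt4 Q%:R.
Proof.
elim: Q => [|Q IH]; first by rewrite big_ord0 mulr_ge0 ?rt4_ge0.
rewrite big_ord_recr /=.
set a := rt4 Q.+1%:R; set b := rt4 Q%:R in IH.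
have a0 : 0 < a by exact: rt4_gt0.
have b0 : 0 <= b by exact: rt4_ge0.
have ab : b <= a by rewrite ler_rt4 ?ler_nat.
have e1 : a ^+ 4 - b ^+ 4 = 1 by rewrite !rt4K ?ler0n// -natrB// subSnn.
have : (a ^+ 3)^-1 <= 4 * (a - b).
  rewrite -[_^-1]mul1r ler_pdivrMr ?exprn_gt0// -[leLHS]e1.
  by apply: (@expr_sub_le a b 3); rewrite b0.
lra.
Qed.

(** The exponent -9/8 is summable: each term after the first is at most 8 times a decrement of the
    inverse eighth root. Keeping the remainder of the telescoping sum makes the induction work. *)
Lemma sum_rt8_inv9 (k : nat) : \sum_(j < k) (rt8 j.+1%:R ^+ 9)^-1 <= 9.
Proof.
case: k => [|k]; first by rewrite big_ord0.
suff : \sum_(j < k.+1) (rt8 j.+1%:R ^+ 9)^-1 <= 9 - 8 * (rt8 k.+1%:R)^-1.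
  move/le_trans; apply; rewrite gerDl oppr_le0 mulr_ge0// invr_ge0 rt8_ge0//.
elim: k => [|k IH].
  by rewrite big_ord1 /rt8 /rt4 !sqrtr1 expr1n !invr1; lra.
rewrite big_ord_recr /=.
set a := rt8 k.+2%:R; set b := rt8 k.+1%:R in IH.
have a0 : 0 < a by exact: rt8_gt0.
have b0 : 0 < b by exact: rt8_gt0.
have ab : b <= a by rewrite ler_rt8 ?ler_nat.
have e1 : a ^+ 8 - b ^+ 8 = 1 by rewrite !rt8K ?ler0n// -natrB// subSnn.
have h : 1 <= 8 * (a - b) * a ^+ 7.
  by rewrite -[leLHS]e1; apply: (@expr_sub_le a b 7); rewrite ab ltW.
suff : (a ^+ 9)^-1 <= 8 * b^-1 - 8 * a^-1 by lra.
have -> : 8 * b^-1 - 8 * a^-1 = 8 * (a - b) / (a * b).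
  by field; rewrite !gt_eqF.
rewrite ler_pdivlMr ?mulr_gt0// mulrC ler_pdivrMr ?exprn_gt0//.
have -> : 8 * (a - b) * a ^+ 9 = a * a * (8 * (a - b) * a ^+ 7) by ring.
apply: le_trans (_ : a * a * 1 <= _); first by rewrite mulr1; nra.
by rewrite ler_wpM2l// mulr_ge0// ltW.
Qed.

Lemma sum_rt4_div3 (Q : nat) :
  \sum_(q < Q) rt4 (Q%:R / q.+1%:R) ^+ 3 <= 4 * Q%:R.
Proof.
have rt4V (x : R) : 0 < x -> rt4 x^-1 = (rt4 x)^-1.
  by move=> x0; rewrite /rt4 !sqrtrV// ?sqrtr_ge0// ltW.
under eq_bigr do rewrite rt4M// rt4V// exprMn exprVn.
rewrite -mulr_sumr.
apply: le_trans (_ : rt4 Q%:R ^+ 3 * (4 * rt4 Q%:R) <= _).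
  by rewrite ler_wpM2l ?exprn_ge0 ?rt4_ge0// sum_rt4_inv3.
by rewrite mulrCA -exprSr rt4K.
Qed.

End Roots.

Section DiophantineSlices.
Variable R : realType.
Implicit Types U V : R.

(** The rotation by [V] of the circle of length [U] returns after [q] steps to within [U / 2 ^+ j]
    of its start. *)
Definition near_period U V (j q : nat) : bool :=
  `[< exists m : int, `|q%:R * V - m%:~R * U| <= U / 2 ^+ j >].

(* For fixed j the weights divided by 2^j sum over q <= 2^j to O(j^(-9/8)), which is
   summable, while bounded weighted sums still force the sum of the first k ratios
   2^j / q to be O(k^(3/2)). *)
Definition dioph_weight (j q : nat) : R :=
  rt4 (2 ^+ j / q%:R) ^+ 3 / rt8 j.+1%:R ^+ 9.

Definition dioph_sum U V (k : nat) : R :=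
  \sum_(j < k) \sum_(q < 2 ^ j)
    dioph_weight j q.+1 * (near_period U V j q.+1)%:R.

Lemma dioph_weight_ge0 j q : 0 <= dioph_weight j q.
Proof. by rewrite mulr_ge0 ?invr_ge0 ?exprn_ge0 ?rt4_ge0 ?rt8_ge0. Qed.

(** On a slice, the event weighted by [dioph_weight j q] will have measure [O(1 / 2 ^ j)], so this
    bounds the integral of [dioph_sum] uniformly in [k]. The 36 is 4 from the sum over [q] times 9
    from the sum over [j]. *)
Lemma sum_dioph_weight (k : nat) :
  \sum_(j < k) \sum_(q < 2 ^ j) dioph_weight j q.+1 / 2 ^+ j <= 36.
Proof.
apply: le_trans (_ : \sum_(j < k) 4 * (rt8 j.+1%:R ^+ 9)^-1 <= _); last first.
  by rewrite -mulr_sumr; have := @sum_rt8_inv9 R k; lra.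
apply: ler_sum => j _; rewrite -mulr_suml ler_pdivrMr ?exprn_gt0//.
rewrite /dioph_weight -mulr_suml mulrAC ler_wpM2r ?invr_ge0 ?exprn_ge0 ?rt8_ge0//.
by have := @sum_rt4_div3 R (2 ^ j)%N; rewrite natrX.
Qed.

Lemma subset_centered_itv (F : set R) (r : R) :
  (forall s s', F s -> F s' -> `|s - s'| <= r) ->
  exists x, F `<=` `[x - r, x + r].
Proof.
move=> diamF; have [->|/set0P[x Fx]] := eqVneq F set0; first by exists 0.
exists x => s Fs; have := diamF _ _ Fs Fx.
by rewrite ler_norml /= in_itv /=; lra.
Qed.

(* The fractions [V / U] with [near_period U V j q] lie within [1 / (q 2^j)] of one of
   O(q) fractions [m / q], and [s |-> V s / U s] expands distances. *)
Lemma unbounded_dioph_sum_negligible (S : set R) (U V : R -> R) (b : nat) (D : R) :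
  D != 0 ->
  (forall s, S s -> 1 <= U s <= b%:R /\ `|V s| <= b%:R) ->
  (forall s s', S s -> S s' -> V s * U s' - V s' * U s = D * (s - s')) ->
  (@lebesgue_measure R).-negligible
    [set s | S s /\ forall C, exists k, C < dioph_sum (U s) (V s) k].
Proof.
move=> D0 UV det.
have nD0 : 0 < `|D| by rewrite normr_gt0.
pose r j q : R := 2 * b%:R ^+ 2 / (`|D| * (q%:R * 2 ^+ j)).
pose F j q (m : int) := [set s | S s /\ `|q%:R * V s - m%:~R * U s| <= U s / 2 ^+ j].
have diamF j q m : (0 < q)%N -> forall s s', F j q m s -> F j q m s' -> `|s - s'| <= r j q.
  move=> q0 s s' [Ss hs] [Ss' hs'].
  have qR : 0 < q%:R :> R by rewrite ltr0n.
  have p0 : 0 < 2 ^+ j :> R by rewrite exprn_gt0.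
  rewrite /r ler_pdivlMr ?mulr_gt0//.
  have [/andP[U1 Ub] _] := UV s Ss; have [/andP[U1' Ub'] _] := UV s' Ss'.
  have -> : `|s - s'| * (`|D| * (q%:R * 2 ^+ j)) = 2 ^+ j * `|q%:R * (D * (s - s'))|.
    by rewrite !normrM (gtr0_norm qR); ring.
  rewrite -det// -ler_pdivlMl//.
  (* As both points share the same [m], it cancels from the determinant, leaving only the two
     approximation errors. *)
  have -> : q%:R * (V s * U s' - V s' * U s) =
    (q%:R * V s - m%:~R * U s) * U s' - (q%:R * V s' - m%:~R * U s') * U s by ring.
  apply: le_trans (ler_normB _ _) _; rewrite !normrM.
  rewrite (@ger0_norm _ (U s)) ?(@ger0_norm _ (U s')); [|lra|lra].
  apply: le_trans (_ : U s / 2 ^+ j * U s' + U s' / 2 ^+ j * U s <= _).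
    by rewrite lerD// ler_wpM2r//; lra.
  have -> : U s / 2 ^+ j * U s' + U s' / 2 ^+ j * U s = (2 ^+ j)^-1 * (2 * (U s * U s')).
    by ring.
  rewrite ler_wpM2l ?invr_ge0 ?(ltW p0)// expr2 ler_wpM2l//.
  by apply: ler_pM => //; lra.
have cover j q m : exists x, (0 < q)%N -> F j q m `<=` `[x - r j q, x + r j q].
  have [->|q0] := posnP q; first by exists 0.
  by have [x ?] := subset_centered_itv (diamF j q m q0); exists x.
pose x j q m := projT1 (cid (cover j q m)).
have xP j q m : (0 < q)%N -> F j q m `<=` `[x j q m - r j q, x j q m + r j q].
  exact: projT2 (cid (cover j q m)).
pose I j q m : set R := `[x j q m - r j q, x j q m + r j q]%classic.
(* A bound for [|m|]: the approximation gives [|m| U <= q b + U] with [U >= 1]. The index [i] of the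
   union below is [m] shifted by [h q]. *)
pose h q := (q * b.+1)%N.
pose E j q := \big[setU/set0]_(i < (h q).*2.+1) I j q (i%:Z - (h q)%:Z).
have mE j q : measurable (E j q).
  by apply: bigsetU_measurable => i _; exact: measurable_itv.
have r0 j q : 0 <= r j q.
  by rewrite !mulr_ge0 ?invr_ge0 ?mulr_ge0 ?exprn_ge0 ?normr_ge0.
have muI j q m : (lebesgue_measure (I j q m) <= (2 * r j q)%:E)%E.
  rewrite lebesgue_measure_itv/= lte_fin.
  by case: ltrP => _; rewrite -?EFinB lee_fin ?mulr_ge0//; lra.
have muE j q : (0 < q)%N ->
  (lebesgue_measure (E j q) <= (12 * b.+1%:R * b%:R ^+ 2 / `|D| / 2 ^+ j)%:E)%E.
  move=> q0; apply: le_trans (@Boole_inequality _ _ _ lebesgue_measure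
    (fun i : nat => I j q (i%:Z - (h q)%:Z)) _ _) _.
    by move=> i _; exact: measurable_itv.
  apply: le_trans (_ : (\sum_(i < (h q).*2.+1) (2 * r j q)%:E <= _)%E).
    by apply: lee_sum => i _; exact: muI.
  rewrite sumEFin lee_fin sumr_const card_ord -[_ *+ _]mulr_natl /r.
  have qR : 0 < q%:R :> R by rewrite ltr0n.
  (* At most [3 * h q] intervals of length [2 * r j q] occur. The factor [q] in [h q] cancels the
     one in the denominator of [r j q], so the bound depends on [j] only. *)
  have -> : 12 * b.+1%:R * b%:R ^+ 2 / `|D| / 2 ^+ j =
     (3 * h q)%:R * (2 * (2 * b%:R ^+ 2 / (`|D| * (q%:R * 2 ^+ j)))) :> R.
    rewrite /h !natrM; field.
    by apply/and3P; split; rewrite gt_eqF ?exprn_gt0.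
  rewrite ler_wpM2r ?(mulr_ge0 _ (r0 j q))// ler_nat /h.
  have : (0 < q * b.+1)%N by rewrite muln_gt0 q0.
  by move: (q * b.+1)%N => x0; lia.
pose K := 12 * b.+1%:R * b%:R ^+ 2 / `|D| : R.
have K0 : 0 <= K by rewrite !mulr_ge0 ?invr_ge0 ?exprn_ge0.
apply: negligibleS (@negligible_unbounded_indic_sums _ _ _ lebesgue_measure
  (fun j => 2 ^ j)%N (fun j q => E j q.+1) (fun j q => dioph_weight j q.+1)
  (fun j _ => K / 2 ^+ j) (36 * K) _ _ _ _) => //.
- move=> s [Ss unb] C; have [k Ck] := unb C; exists k; apply: lt_le_trans Ck _.
  apply: ler_sum => j _; apply: ler_sum => q _.
  rewrite ler_wpM2l ?dioph_weight_ge0//.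
  rewrite /near_period; case: asboolP => [[m hm]|_]; last by rewrite indicE ler0n.
  rewrite indicE mem_set// /E.
  rewrite -(bigcup_mkord _ (fun i : nat => I j q.+1 (i%:Z - (h q.+1)%:Z))).
  have [/andP[U1 Ub] Vb] := UV s Ss.
  have mh : `|m| <= (h q.+1)%:Z.
    rewrite -(ler_int R) intr_norm; set M := m%:~R in hm *.
    rewrite -pmulrn /h natrM.
    have p1 : 1 <= 2 ^+ j :> R by rewrite exprn_ege1// ler1n.
    have q1 : 1 <= q.+1%:R :> R by rewrite ler1n.
    have Uj : U s / 2 ^+ j <= U s by rewrite ler_piMr ?invf_le1 ?exprn_gt0//; lra.
    have MU : `|M| * U s <= q.+1%:R * b%:R + U s.
      rewrite -[U s in leLHS]ger0_norm -?normrM; last lra.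
      have -> : M * U s = q.+1%:R * V s - (q.+1%:R * V s - M * U s) by ring.
      apply: le_trans (ler_normB _ _) _; apply: lerD; last exact: le_trans hm Uj.
      by rewrite normrM ger0_norm ?ler0n// ler_wpM2l ?ler0n.
    rewrite -[b.+1]addn1 natrD mulrDr mulr1.
    have [|M1] := lerP `|M| 1; first by have : 0 <= q.+1%:R * b%:R :> R by []; lra.
    have M1' : `|M| - 1 <= (`|M| - 1) * U s by rewrite ler_peMr//; lra.
    lra.
  exists (absz (m + (h q.+1)%:Z)); first by rewrite /=; lia.
  have -> : (absz (m + (h q.+1)%:Z))%:Z - (h q.+1)%:Z = m by lia.
  exact: xP.
- by move=> j q; exact: mE.
- by move=> j q; exact: dioph_weight_ge0.
- by move=> j q; exact: muE.

- move=> k.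
  rewrite (_ : \sum_(_ < _) _ = K * \sum_(j < k) \sum_(q < 2 ^ j) dioph_weight j q.+1 / 2 ^+ j).
    by rewrite mulrC ler_wpM2r// sum_dioph_weight.
  rewrite mulr_sumr; apply: eq_bigr => j _; rewrite mulr_sumr; apply: eq_bigr => q _.
  by rewrite mulrCA mulrA.
Qed.

End DiophantineSlices.

(** * Dirichlet approximation and the deterministic Diophantine condition *)

Section Dirichlet.
Variable R : realType.
Implicit Types U V : R.

(** Pigeonhole: among the fractional parts of [Q + 1] multiples of [V / U], two lie in the same of
    [Q] boxes. The resulting fraction is then put in lowest terms. *)
Lemma dirichlet_approx U V (Q : nat) : 0 < U -> (0 < Q)%N ->
  exists q (m : int), [/\ (0 < q <= Q)%N, coprime q `|m|%N &
    `|q%:R * V - m%:~R * U| <= U / Q%:R].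
Proof.
move=> U0 Q0; have QR : 0 < Q%:R :> R by rewrite ltr0n.
pose fl k := Num.floor (k%:R * V / U).
pose fr k := k%:R * V / U - (fl k)%:~R.
have fr01 k : 0 <= fr k < 1.
  have := floor_itv (k%:R * V / U); rewrite -/(fl k) intrD /fr; lra.
have boxP k : 0 <= Q%:R * fr k < Q%:R.
  by have /andP[? ?] := fr01 k; rewrite mulr_ge0//= gtr_pMr.
have boxQ (k : 'I_Q.+1) : (Num.truncn (Q%:R * fr k) < Q)%N.
  have /andP[h0 hQ] := boxP k.
  by rewrite -(ltr_nat R); apply: le_lt_trans hQ; rewrite truncn_le.
pose box (k : 'I_Q.+1) : 'I_Q := Ordinal (boxQ k).
have /injectivePn[k [k' kk' bb]] : ~~ injectiveb box.
  by apply/negP => /injectiveP/leq_card; rewrite !card_ord ltnn.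
wlog lkk' : k k' kk' bb / (k < k')%N.
  move=> wl; have : (k : nat) != k' by [].
  rewrite neq_ltn => /orP[|] h; first exact: (wl k k').
  by apply: (wl k' k) => //; rewrite eq_sym.
pose q := (k' - k)%N; pose m := fl k' - fl k.
have hfr : `|fr k' - fr k| <= Q%:R^-1.
  rewrite -[leRHS]mul1r ler_pdivlMr// -[in leLHS](gtr0_norm QR) -normrM.
  have /andP[/truncn_itv + _] := boxP k.
  have /andP[/truncn_itv + _] := boxP k'.
  have /(congr1 (@nat_of_ord _)) /= -> := bb.
  rewrite -[(Num.truncn _).+1]addn1 natrD ler_norml mulrBl; lra.
have hq : `|q%:R * V - m%:~R * U| <= U / Q%:R.
  have -> : q%:R * V - m%:~R * U = U * (fr k' - fr k).
    by rewrite /fr /q /m natrB ?(ltnW lkk')// intrB; field; rewrite gt_eqF.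
  by rewrite normrM gtr0_norm// ler_wpM2l// ltW.
have q0 : (0 < q)%N by rewrite subn_gt0.
have qQ : (q <= Q)%N by have := ltn_ord k'; rewrite /q; lia.
move: q m q0 qQ hq => q m q0 qQ hq.
(* Dividing by the gcd only reduces the approximation error and the denominator. *)
pose g := gcdn q `|m|; have g0 : (0 < g)%N by rewrite gcdn_gt0 q0.
pose q1 := (q %/ g)%N; pose m1 := (`|m| %/ g)%N.
have qE : q = (q1 * g)%N by rewrite divnK// dvdn_gcdl.
have mE : m = sgz m * m1%:Z * g%:Z.
  by rewrite -mulrA -PoszM divnK ?dvdn_gcdr// -intEsg.
exists q1, (sgz m * m1%:Z); split.
- have := dvdn_gcdl q `|m|; rewrite divn_gt0// -/g => /(dvdn_leq q0) -> /=.
  exact: leq_trans (leq_div _ _) qQ.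
- rewrite abszM; have [m0|m0] := eqVneq m 0.
    rewrite m0 sgz0 mul0n /coprime gcdn0 /q1 /g m0 absz0 gcdn0 divnn q0//.
  rewrite absz_sg m0 mul1n /coprime -(eqn_pmul2r g0) mul1n muln_gcdl -qE.
  by rewrite divnK ?dvdn_gcdr.
- apply: le_trans hq.
  have -> : q%:R * V - m%:~R * U = g%:R * (q1%:R * V - (sgz m * m1%:Z)%:~R * U).
    by rewrite [in LHS]mE [in LHS]qE natrM !intrM -!pmulrn; ring.
  by rewrite normrM normr_nat ler_peMl// ler1n.
Qed.

(** [Q j] is the denominator of a reduced approximation of [V / U] at scale [2 ^ j]. The sum of
    ratios controls the discrepancy of the rotation up to time [2 ^ k], and its bound is of order
    [k] to the power 3/2. *)
Definition diophantine U V : Prop :=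
  exists (Q : nat -> nat) (c : R),
    (forall j, exists m : int, [/\ (0 < Q j <= 2 ^ j)%N, coprime (Q j) `|m|%N &
       `|(Q j)%:R * V - m%:~R * U| <= U / 2 ^+ j]) /\
    forall k, \sum_(j < k) 2 ^+ j / (Q j)%:R <= c * rt8 k%:R ^+ 12.

(** Let [z j] be the fourth root of [2 ^ j / Q j]. A single term of the weighted sum gives
    [z j <= c e ^ 3] with [e] the eighth root of [k], as [c >= 1]. Writing [z j ^ 4] as [z j ^ 3]
    times [z j] and removing the weight costs [e ^ 9], so the total is [c ^ 2 e ^ 12]. *)
Lemma bounded_dioph_sum_diophantine U V (C : R) : 0 < U ->
  (forall k, dioph_sum U V k <= C) -> diophantine U V.
Proof.
move=> U0 sumC.
have ex j : exists q, exists m : int, [/\ (0 < q <= 2 ^ j)%N, coprime q `|m|%N &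
    `|q%:R * V - m%:~R * U| <= U / 2 ^+ j].
  have [|q [m [? ? h]]] := @dirichlet_approx U V (2 ^ j) U0; first by rewrite expn_gt0.
  by exists q, m; split; rewrite // -natrX.
pose Q j := projT1 (cid (ex j)).
have QP j : exists m : int, [/\ (0 < Q j <= 2 ^ j)%N, coprime (Q j) `|m|%N &
    `|(Q j)%:R * V - m%:~R * U| <= U / 2 ^+ j] by exact: projT2 (cid (ex j)).
pose c := 1 + `|C|; have c1 : 1 <= c by rewrite lerDl.
pose z j := rt4 (2 ^+ j / (Q j)%:R) : R.
have z0 j : 0 <= z j by exact: rt4_ge0.
have sumz k : \sum_(j < k) z j ^+ 3 / rt8 j.+1%:R ^+ 9 <= c.
  apply: le_trans (_ : dioph_sum U V k <= _); last first.
    by have := sumC k; have := ler_norm C; rewrite /c; lra.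
  apply: ler_sum => j _; have [m [/andP[Q0 Qj] cop near]] := QP j.
  have Qlt : ((Q j).-1 < 2 ^ j)%N by rewrite prednK.
  rewrite (bigD1 (Ordinal Qlt))//= prednK// -[leLHS]addr0 lerD//.
    rewrite (_ : near_period U V j (Q j)) ?mulr1//.
    by apply/asboolP; exists m.
  by apply: sumr_ge0 => q _; rewrite mulr_ge0// dioph_weight_ge0.
exists Q, (c ^+ 2); split=> // k.
pose e := rt8 k%:R : R; have e0 : 0 <= e by exact: rt8_ge0.
have zk j : (j < k)%N -> z j <= c * e ^+ 3.
  move=> jk; rewrite -(@ler_pXn2r _ 3)// ?nnegrE ?mulr_ge0 ?exprn_ge0//; last lra.
  rewrite exprMn -exprM.
  have r0 : 0 < rt8 j.+1%:R ^+ 9 :> R by rewrite exprn_gt0 ?rt8_gt0.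
  have h1 : z j ^+ 3 / rt8 j.+1%:R ^+ 9 <= c.
    apply: le_trans (sumz k); rewrite (bigD1 (Ordinal jk))//= lerDl.
    by apply: sumr_ge0 => i _; rewrite mulr_ge0 ?invr_ge0 ?exprn_ge0 ?rt8_ge0.
  rewrite ler_pdivrMr// in h1; apply: le_trans h1 _.
  apply: ler_pM; rewrite ?exprn_ge0 ?rt8_ge0//; first lra.
    by rewrite exprS ler_peMr ?exprn_ege1//; lra.
  by rewrite lerXn2r ?nnegrE ?rt8_ge0// ler_rt8// ler_nat.
apply: le_trans (_ : \sum_(j < k) (z j ^+ 3 / rt8 j.+1%:R ^+ 9) * (e ^+ 9 * (c * e ^+ 3)) <= _).
  apply: ler_sum => j _.
  have -> : 2 ^+ j / (Q j)%:R = z j ^+ 3 * z j :> R.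
    by rewrite -exprSr rt4K// mulr_ge0 ?invr_ge0 ?exprn_ge0.
  have r0 : 0 < rt8 j.+1%:R ^+ 9 :> R by rewrite exprn_gt0 ?rt8_gt0.
  rewrite -mulrA ler_wpM2l ?exprn_ge0// mulrA.
  apply: le_trans (zk _ (ltn_ord j)) _; rewrite ler_peMl//.
    by rewrite mulr_ge0 ?exprn_ge0//; lra.
  rewrite mulrC ler_pdivlMr// mul1r.
  by rewrite lerXn2r ?nnegrE ?rt8_ge0// ler_rt8// ler_nat.
rewrite -mulr_suml; have -> : c ^+ 2 * rt8 k%:R ^+ 12 = c * (e ^+ 9 * (c * e ^+ 3)).
  by rewrite -/e; ring.
by rewrite ler_wpM2r// !mulr_ge0 ?exprn_ge0//; lra.
Qed.

End Dirichlet.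

(** * From slices to almost every point of the simplex *)

Section AlmostEveryDiophantine.
Variables (R : realType) (A : finType).
Local Notation n := #|A|.-1.
Local Notation mR := (measurableTypeR R).
Implicit Types (z u v : A -> int) (t : n.-tuple mR) (a b l : A).

Definition lin_form z (lam : A -> R) : R := \sum_a (z a)%:~R * lam a.

(** A coordinate of the chart trades length between its own letter [a0] and the omitted letter [l].
    Linear forms are therefore affine in it, with slope [z a0 - z l]. *)
Lemma simplex_chart_set_coord l a0 t (i : 'I_n) (s s' : R) a :
  enum_rank l = n :> nat -> enum_rank a0 = i :> nat ->
  simplex_chart (set_coord t i s) a - simplex_chart (set_coord t i s') a
  = (s - s') * ((a == a0)%:R - (a == l)%:R).
Proof.
move=> ln a0i; rewrite /simplex_chart.
have rk b (x : nat) b' : enum_rank b' = x :> nat -> (b == b') = (enum_rank b == x :> nat).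
  by move=> <-; rewrite val_eqE (inj_eq enum_rank_inj).
rewrite (rk _ _ _ ln) (rk _ _ _ a0i).
have h0 : (enum_rank a <= n)%N.
  by rewrite -ltnS prednK ?ltn_ord//; apply/card_gt0P; exists a.
case: (ltnP (enum_rank a) n) => h.
  rewrite (ltn_eqF h) subr0 -!(tnth_nth 0 _ (Ordinal h)) !tnth_mktuple.
  rewrite -val_eqE /=; by case: eqP => _; rewrite ?subrr (mulr1, mulr0).
have -> : (enum_rank a == n :> nat) by rewrite eqn_leq h0.
rewrite !big_tuple [_ == (i : nat)]gtn_eqF ?(leq_trans (ltn_ord i))//.
rewrite (bigD1 i)//= [X in _ - (1 - X)](bigD1 i)//= !tnth_mktuple eqxx.
rewrite (eq_bigr (tnth t)); last first.
  by move=> k /negPf ki; rewrite tnth_mktuple ki.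
rewrite [X in _ - (1 - (_ + X))](eq_bigr (tnth t)); last first.
  by move=> k /negPf ki; rewrite tnth_mktuple ki.
ring.
Qed.

Lemma lin_form_set_coord z l a0 t (i : 'I_n) (s s' : R) :
  enum_rank l = n :> nat -> enum_rank a0 = i :> nat ->
  lin_form z (simplex_chart (set_coord t i s)) =
  lin_form z (simplex_chart (set_coord t i s')) + (s - s') * (z a0 - z l)%:~R.
Proof.
move=> ln a0i; set L := lin_form z (simplex_chart (set_coord t i s)).
set L' := lin_form z (simplex_chart (set_coord t i s')).
suff <- : L - L' = (s - s') * (z a0 - z l)%:~R by rewrite addrC subrK.
rewrite /L /L' /lin_form -sumrB.
under eq_bigr do rewrite -mulrBr (simplex_chart_set_coord _ _ _ _ ln a0i) mulrCA mulrBr.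
rewrite -mulr_sumr sumrB intrB; congr (_ * (_ - _)).
  by rewrite (bigD1 a0)//= eqxx mulr1 big1 ?addr0// => b /negPf ->; rewrite mulr0.
by rewrite (bigD1 l)//= eqxx mulr1 big1 ?addr0// => b /negPf ->; rewrite mulr0.
Qed.

Lemma measurable_simplex_chart a :
  measurable_fun setT (fun t => simplex_chart t a : R).
Proof.
rewrite /simplex_chart; case: ltnP => h.
  under eq_fun do rewrite -(tnth_nth 0 _ (Ordinal h)).
  exact: measurable_tnth.
under eq_fun do rewrite big_tuple.
apply: measurable_funB => //; apply: measurable_sum => k; exact: measurable_tnth.
Qed.

Lemma measurable_lin_form z :
  measurable_fun setT (fun t => lin_form z (simplex_chart t) : R).
Proof.
apply: measurable_sum => a; apply: measurable_funM => //.
exact: measurable_simplex_chart.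
Qed.

Lemma measurable_dioph_sum u v k : measurable_fun setT
  (fun t => dioph_sum (lin_form u (simplex_chart t)) (lin_form v (simplex_chart t)) k : R).
Proof.
apply: measurable_sum => j; apply: measurable_sum => q; apply: measurable_funM => //.
set U := fun t => lin_form u (simplex_chart t) : R.
set V := fun t => lin_form v (simplex_chart t) : R.
have mU : measurable_fun setT U by exact: measurable_lin_form.
have mV : measurable_fun setT V by exact: measurable_lin_form.
pose F (m : int) := [set t | `|q.+1%:R * V t - m%:~R * U t| <= U t / 2 ^+ j].
(* The existential over the integer [m] becomes a countable union, taken over the absolute value of
   [m] with both signs. *)
pose E := \bigcup_(k : nat) (F k%:Z `|` F (- k%:Z)).
rewrite (_ : (fun t => _) = \1_E); last first.
  apply/funext => t; rewrite indicE /near_period; congr (_%:R).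
  congr nat_of_bool; apply/idP/idP.
    move=> /asboolP[m hm]; rewrite inE; exists `|m|%N => //.
    have [m0|m0] := lerP 0 m; [left | right].
      by rewrite /F /= gez0_abs.
    by rewrite /F /= ltz0_abs// opprK.
  by rewrite inE => -[r _ [|] hm]; apply/asboolP; eexists; exact: hm.
apply: measurable_indic; apply: bigcup_measurable => r _.
have mF m : measurable (F m).
  rewrite -[X in measurable X]setTI; apply: measurable_fun_le => //.
    apply: measurableT_comp => //.
    by apply: measurable_funB; exact: measurable_funM.
  exact: measurable_funM.
exact: measurableU.
Qed.

Lemma simplex_lin_form_ge1 u (lam : A -> R) :
  (forall a, 1 <= u a) -> simplex lam -> 1 <= lin_form u lam.
Proof.
move=> u1 [l0 l1]; rewrite -[leLHS]l1; apply: ler_sum => a _.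
by rewrite ler_peMl ?(ltW (l0 a))// ler1z.
Qed.

Lemma simplex_norm_lin_form z (lam : A -> R) :
  simplex lam -> `|lin_form z lam| <= (\sum_a `|z a|%N)%:R.
Proof.
move=> [l0 l1]; apply: le_trans (ler_norm_sum _ _ _) _.
rewrite natr_sum; apply: ler_sum => a _.
rewrite normrM -intr_norm -[`|z a|%:~R]/((absz (z a))%:~R) (gtr0_norm (l0 a)).
rewrite -pmulrn ler_piMr//.
by rewrite -l1 (bigD1 a)//= lerDl sumr_ge0// => b _; exact: ltW.
Qed.

(** In the direction of [a0] the form has nonzero slope, so every line in that direction meets the
    set in at most one point. *)
Lemma leb_hyperplane_negligible z l a0 (i : 'I_n) (c : R) :
  enum_rank l = n :> nat -> enum_rank a0 = i :> nat -> z a0 != z l ->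
  (leb R n).-negligible [set t | lin_form z (simplex_chart t) = c].
Proof.
move=> ln a0i zl; apply: (leb_slice_negligible (i := i)).
  rewrite -[X in measurable X]setTI.
  exact: (@measurable_lin_form z measurableT [set c] (measurable_set1 c)).
move=> t; set N := [set s | _].
suff [x Nx] : exists x, N `<=` [set x].
  have : (@lebesgue_measure R).-negligible [set x]; last exact: negligibleS.
  by apply/negligibleP; [exact: measurable_set1 | exact: lebesgue_measure_set1].
have [->|/set0P[x Nx]] := eqVneq N set0; first by exists 0.
exists x => s; move: Nx; rewrite /N /= (lin_form_set_coord _ _ s x ln a0i) => ->.
move/eqP; rewrite -[eqbRHS]addr0 (inj_eq (addrI _)) mulf_eq0 intr_eq0 [z a0 - _ == 0]subr_eq0 (negPf zl) orbF.
by rewrite subr_eq0 => /eqP.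
Qed.

End AlmostEveryDiophantine.

Section AlmostEveryDiophantineMain.
Variables (R : realType) (A : finType).
Local Notation n := #|A|.-1.
Local Notation mR := (measurableTypeR R).
Implicit Types (z u v : A -> int).

(** Along the coordinate of [a0] both forms [U] and [V] are affine, and the determinant
    [V s * U s' - V s' * U s] is [s - s'] times the form of [w]. That form is constant along the
    line, so the slice estimate applies with it as [D]. *)
Lemma leb_unbounded_dioph_sum_negligible u v l a0 (i : 'I_n) (w : A -> int) :
  enum_rank l = n :> nat -> enum_rank a0 = i :> nat ->
  (forall a, 1 <= u a) ->
  (forall b, w b = (v a0 - v l) * u b - (u a0 - u l) * v b) ->
  (leb R n).-negligible [set t | [/\ simplex (simplex_chart t), lin_form w (simplex_chart t) != 0 &
    forall c : nat, exists k, c%:R < dioph_sum (lin_form u (simplex_chart t))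
                                      (lin_form v (simplex_chart t)) k]].
Proof.
move=> ln a0i u1 wE.
pose U t := lin_form u (simplex_chart t) : R.
pose V t := lin_form v (simplex_chart t) : R.
pose W t := lin_form w (simplex_chart t) : R.
have WE t : W t = (v a0 - v l)%:~R * U t - (u a0 - u l)%:~R * V t.
  rewrite /W /U /V /lin_form !mulr_sumr -sumrB; apply: eq_bigr => b _.
  by rewrite wE !intrB !intrM !intrB; ring.
apply: (leb_slice_negligible (i := i)).
  have mU := measurable_lin_form (R := R) u; have mW := measurable_lin_form (R := R) w.
  rewrite (_ : [set t | _] =
    ((\bigcap_(a in [set: A]) [set t | 0 < simplex_chart t a]) `&`
     [set t | \sum_a simplex_chart t a = 1]) `&` (~` [set t | W t = 0] `&`
     \bigcap_(c in [set: nat]) \bigcup_(k in [set: nat])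
        [set t | c%:R < dioph_sum (U t) (V t) k])); last first.
    apply/seteqP; split=> t /=.
      move=> [[h1 h2] h3 h4]; split; first by split=> // a _; exact: h1.
      split; first exact/eqP.
      by move=> c _; have [k hk] := h4 c; exists k.
    move=> [[h1 h2] [h3 h4]]; split; first by split=> // a; exact: h1.
      exact/eqP.
    by move=> c; have [k _ hk] := h4 c I; exists k.
  apply: measurableI; [apply: measurableI|apply: measurableI].
  - apply: fin_bigcap_measurable => // a _.
    rewrite -[X in measurable X]setTI.
    by apply: measurable_fun_ltr => //; exact: measurable_simplex_chart.
  - have mS : measurable_fun setT (fun t : n.-tuple mR => \sum_a simplex_chart t a : R).
      by apply: measurable_sum => a; exact: measurable_simplex_chart.
    rewrite -[X in measurable X]setTI.
    exact: (mS measurableT [set 1] (measurable_set1 1)).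
  - apply: measurableC; rewrite -[X in measurable X]setTI.
    exact: (mW measurableT [set 0] (measurable_set1 0)).
  - apply: bigcapT_measurable => c; apply: bigcupT_measurable => k.
    rewrite -[X in measurable X]setTI.
    by apply: measurable_fun_ltr => //; exact: measurable_dioph_sum.
move=> t; pose ts s := set_coord t i s; pose D := W (ts 0).
have WD s : W (ts s) = D.
  rewrite /W (lin_form_set_coord _ _ s 0 ln a0i) -/(W _) -/D.
  by rewrite (_ : w a0 - w l = 0) ?mulr0 ?addr0// !wE; ring.
have [D0|D0] := eqVneq D 0.
  rewrite (_ : [set s | _] = set0); first exact: negligible_set0.
  by apply/seteqP; split=> // s [_ /eqP + _]; rewrite -/(ts s) -/(W _) WD.
pose S := [set s | simplex (simplex_chart (ts s))].
pose b := (\sum_a `|u a| + \sum_a `|v a|)%N.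
apply: negligibleS (@unbounded_dioph_sum_negligible R S (U \o ts) (V \o ts) b D D0 _ _).
- move=> s /= [Ss _ unb]; split=> // C.
  have [k hk] := unb (Num.truncn `|C|).+1; exists k; apply: le_lt_trans hk.
  by apply: le_trans (ler_norm C) _; rewrite ltW// truncnS_gt.
- move=> s Ss /=; rewrite simplex_lin_form_ge1//= /b natrD.
  have := simplex_norm_lin_form u Ss; have := simplex_norm_lin_form v Ss.
  have := ler_norm (lin_form u (simplex_chart (ts s))).
  rewrite -/(U _) -/(V _).
  have : 0 <= (\sum_a `|u a|)%:R :> R by []; have : 0 <= (\sum_a `|v a|)%:R :> R by [].
  by move=> *; split; lra.
- move=> s s' _ _ /=; rewrite /U /V !(lin_form_set_coord _ _ s s' ln a0i).
  by rewrite -(WD s') WE /U /V; ring.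
Qed.

(** Some letter [a0] has a pair [(u, v)] different from that of the omitted letter [l], since
    otherwise the wedge would vanish. Beyond the null set of the preceding lemma, only the zero set
    of the form of [w] remains: it is a hyperplane if [w] is not constant, and otherwise it misses
    the simplex. *)
Lemma ae_diophantine u v :
  (forall a, 1 <= u a) -> (exists a b, u a * v b - v a * u b != 0) ->
  @ae_simplex R A (fun lam => diophantine (lin_form u lam) (lin_form v lam)).
Proof.
move=> u1 [a1 [b1 uv]].
have cA : (0 < #|A|)%N by apply/card_gt0P; exists a1.
have lastA : (n < #|A|)%N by rewrite prednK.
pose l : A := enum_val (Ordinal lastA).
have ln : enum_rank l = n :> nat by rewrite enum_valK.
have coord a : a != l -> exists i : 'I_n, enum_rank a = i :> nat.
  move=> al; have ra : (enum_rank a < n)%N.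
    rewrite ltn_neqAle -ltnS prednK// ltn_ord andbT -ln.
    by rewrite val_eqE (inj_eq enum_rank_inj).
  by exists (Ordinal ra).
have [a0 a0P] : exists a, (u a != u l) || (v a != v l).
  apply: contrapT => /forallNP h; move/negP: uv; apply.
  have e a : u a = u l /\ v a = v l.
    by have /negP := h a; rewrite negb_or !negbK => /andP[/eqP ? /eqP].
  by rewrite !(e a1).1 !(e a1).2 !(e b1).1 !(e b1).2 mulrC subrr.
have a0l : a0 != l by apply: contraL a0P => /eqP ->; rewrite !eqxx.
have [i a0i] := coord _ a0l.
pose w b := (v a0 - v l) * u b - (u a0 - u l) * v b.
have N1 := leb_unbounded_dioph_sum_negligible (w := w) ln a0i u1 (fun=> erefl).
set B1 := [set t | _] in N1.
pose B2 := [set t : n.-tuple mR | simplex (simplex_chart t) /\ lin_form w (simplex_chart t) = 0].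
have N2 : (leb R n).-negligible B2.
  have [[a wa]|wconst] := pselect (exists a, w a != w l).
    have al : a != l by apply: contraNneq wa => ->.
    have [j aj] := coord _ al.
    by apply: negligibleS (leb_hyperplane_negligible 0 ln aj wa) => t [].
  rewrite (_ : B2 = set0); first exact: negligible_set0.
  apply/seteqP; split=> // t [[l0 l1] /eqP]; apply/negP.
  have wl a : w a = w l.
    by apply/eqP; apply: contraT => h; exfalso; apply: wconst; exists a.
  rewrite /lin_form (eq_bigr (fun a => (w l)%:~R * simplex_chart t a)) => [|a _]; last by rewrite wl.
  rewrite -mulr_sumr l1 mulr1 intr_eq0.
  apply/eqP => wl0.
  (* If [w] is identically zero, [u] and [v] satisfy a linear relation whose coefficients are not
     both zero, which contradicts the nonzero wedge. *)
  have wz b : (v a0 - v l) * u b = (u a0 - u l) * v b.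
    by apply/eqP; rewrite -subr_eq0 -/(w b) wl wl0.
  have [e0|e0] := eqVneq (u a0 - u l) 0.
    have := wz a0; rewrite e0 mul0r => /eqP; rewrite mulf_eq0 subr_eq0.
    have ul : u a0 = u l by apply/eqP; rewrite -subr_eq0 e0.
    move: a0P; rewrite ul eqxx /= => /negPf ->/=.
    by have := u1 l; lia.
  move/negP: uv; apply; rewrite -(mulrI_eq0 _ (mulfI e0)); apply/eqP.
  have -> : (u a0 - u l) * (u a1 * v b1 - v a1 * u b1) =
    u a1 * ((u a0 - u l) * v b1) - u b1 * ((u a0 - u l) * v a1) by ring.
  by rewrite -!wz; ring.
apply: negligibleS (negligibleU N1 N2) => t /= /not_implyP[st nd].
have [w0|w0] := eqVneq (lin_form w (simplex_chart t)) 0; [right|left] => //.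
split=> // c; apply: contrapT => /forallNP bnd; apply: nd.
apply: (bounded_dioph_sum_diophantine (C := c%:R)).
  exact: lt_le_trans (simplex_lin_form_ge1 u1 st).
by move=> k; rewrite leNgt; apply/negP; exact: bnd.
Qed.

End AlmostEveryDiophantineMain.

(** * Visits of a rotation to an interval *)

Section Visits.
Variables (R : realType) (U V : R).
Hypothesis U1 : 1 <= U.
Implicit Types (y : R) (P q : nat).

Definition hit y : bool := `[< exists l : int, 0 <= y - l%:~R * U < 1 >].

Definition visits y P : nat := \sum_(0 <= k < P) hit (y + k%:R * V).

Lemma visitsD y P P' : visits y (P + P') = (visits y P + visits (y + P%:R * V) P')%N.
Proof.
rewrite /visits (big_cat_nat _ (leq_addr P' P))//=; congr (_ + _)%N.
rewrite -{1}[P]add0n big_addn addKn; apply: eq_bigr => k _.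
by rewrite natrD mulrDl [_ + P%:R * V]addrC addrA.
Qed.

(* Denjoy-Koksma: the [q] points [y + k V] are displaced by less than [U / q] from
   equally spaced points of the circle of length [U]. *)
Lemma visits_period y q (m : int) : (0 < q)%N -> coprime q `|m|%N ->
  `|q%:R * V - m%:~R * U| <= U / q%:R -> (visits y q)%:R <= q%:R / U + 3.
Proof.
move=> q0 cop near; have qR : 0 < q%:R :> R by rewrite ltr0n.
have U0 : 0 < U := lt_le_trans ltr01 U1.
pose Y := y * q%:R / U.
(* A visit at time [k] determines an integer [r], congruent to [k m] modulo [q]: the index of the
   nearby equally spaced point, in units of [U / q]. The window for [r + Y] has length [q / U + 2],
   one unit being allowed for the displacement on each side. *)
have ex (k : 'I_q) : exists r : int, hit (y + k%:R * V) ->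
    (exists l : int, r = k%:Z * m - l * q%:Z) /\ -1 < r%:~R + Y < q%:R / U + 1.
  have [hk|] := boolP (hit (y + k%:R * V)); last by exists 0.
  have /asboolP[l /andP[l0 l1]] := hk.
  exists (k%:Z * m - l * q%:Z) => _; split; first by exists l.
  pose err := k%:R * (q%:R * V - m%:~R * U) / U.
  have errlt : `|err| < 1.
    rewrite /err !normrM normrV ?unitfE ?gt_eqF// normr_nat (gtr0_norm U0).
    rewrite ltr_pdivrMr// mul1r; apply: le_lt_trans (_ : k%:R * (U / q%:R) < _).
      by rewrite ler_wpM2l.
    rewrite mulrCA gtr_pMr// ltr_pdivrMr// mul1r ltr_nat; exact: ltn_ord.
  have e : (k%:Z * m - l * q%:Z)%:~R + Y = (y + k%:R * V - l%:~R * U) * q%:R / U - err.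
    rewrite intrB !intrM -!pmulrn /Y /err; field; rewrite gt_eqF//.
  rewrite e; move: errlt; rewrite ltr_norml => /andP[e1 e2].
  have b0 : 0 <= (y + k%:R * V - l%:~R * U) * q%:R / U.
    by rewrite mulr_ge0 ?invr_ge0 ?mulr_ge0//; lra.
  have b1 : (y + k%:R * V - l%:~R * U) * q%:R / U < q%:R / U.
    by rewrite ltr_pM2r ?invr_gt0// gtr_pMl.
  lra.
pose r (k : 'I_q) := projT1 (cid (ex k)).
have rP (k : 'I_q) : hit (y + k%:R * V) -> (exists l : int, r k = k%:Z * m - l * q%:Z) /\
    -1 < (r k)%:~R + Y < q%:R / U + 1 by exact: projT2 (cid (ex k)).
pose K := [set k : 'I_q | hit (y + k%:R * V)]%SET.
(* Shifted by the floor of [Y] plus 1, the integers [r k] of the visits lie between 0 and [T], so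
   they take at most [T + 1 <= q / U + 3] values. *)
pose T := Num.truncn (q%:R / U + 2).
have qU0 : 0 <= q%:R / U by rewrite mulr_ge0 ?invr_ge0 ?(ltW U0).
pose f (k : 'I_q) := r k + Num.floor Y + 1.
have fP (k : 'I_q) : k \in K -> (0 <= f k) && (`|f k|%N < T.+1)%N.
  rewrite inE => /rP[_ /andP[r1 r2]].
  have := floor_itv Y; rewrite intrD => /andP[Y1 Y2].
  have f0 : 0 <= f k.
    rewrite -ltzD1 -(ltr_int R) /f !intrD; lra.
  rewrite f0 /= ltnS -(ler_nat R).
  have -> : (`|f k|%N)%:R = (f k)%:~R :> R by rewrite pmulrn gez0_abs.
  have : (`|f k|%N)%:R < T.+1%:R :> R.
    have /truncn_itv/andP[_] : 0 <= q%:R / U + 2 by lra.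
    apply: le_lt_trans; rewrite pmulrn gez0_abs// /f !intrD; lra.
  by rewrite ltr_nat ltnS -(ler_nat R) [(_%N)%:R]pmulrn gez0_abs.
have inj : {in K &, injective (fun k => inord `|f k|%N : 'I_T.+1)}.
  move=> k k' kK k'K /(congr1 (@nat_of_ord _)).
  have /andP[fk0 fkT] := fP k kK; have /andP[fk'0 fk'T] := fP k' k'K.
  rewrite !inordK// => e.
  have rr : r k = r k' by move: e fk0 fk'0; rewrite /f; lia.
  rewrite inE in kK; rewrite inE in k'K.
  have [[l rl] _] := rP k kK; have [[l' rl'] _] := rP k' k'K.
  (* Equal values of [r] make [q] divide [(k - k') m]. Coprimality with [m] and [k, k' < q] then
     force [k = k']. *)
  have dv : (q%:Z %| (k%:Z - k'%:Z) * m)%Z.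
    apply/dvdzP; exists (l - l'); move: rr; rewrite rl rl'.
    by move=> e1; rewrite !mulrBl; lia.
  have : (q%:Z %| k%:Z - k'%:Z)%Z.
    by rewrite -(@Gauss_dvdzl _ _ m)// /coprimez /gcdz /= (eqP cop).
  have := ltn_ord k; have := ltn_ord k'; rewrite dvdzE /= => h1 h2 h3.
  apply: val_inj => /=; have [|d0] := posnP `|k%:Z - k'%:Z|%N; first lia.
  by have := dvdn_leq d0 h3; lia.
have -> : visits y q = #|K|.
  rewrite /visits big_mkord -sum1_card [RHS]big_mkcond.
  by apply: eq_bigr => k _; rewrite inE; case: (hit _).
rewrite -(card_in_imset inj).
apply: le_trans (_ : T.+1%:R <= _).
  by rewrite ler_nat -[leqRHS]card_ord max_card.
have : T%:R <= q%:R / U + 2 by rewrite truncn_le; lra.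
rewrite -[T.+1]addn1 natrD; lra.
Qed.

Lemma visits_mul y q b (m : int) : (0 < q)%N -> coprime q `|m|%N ->
  `|q%:R * V - m%:~R * U| <= U / q%:R -> (visits y (b * q))%:R <= b%:R * (q%:R / U + 3).
Proof.
move=> q0 cop near; elim: b => [|b IH].
  by rewrite mul0n /visits big_geq// mul0r.
rewrite mulSn addnC visitsD natrD -[b.+1]addn1 natrD mulrDl mul1r.
by rewrite lerD// (visits_period _ q0 cop).
Qed.

(** Ostrowski-like expansion of [P]: at level [k] split off the full periods of length [Q k]. There
    are at most [2 * (2 ^ k / Q k)] of them, each with error 3, whence the 6. The remainder is below
    [Q k <= 2 ^ k] and passes to the previous level. *)
Lemma visits_le (Q : nat -> nat) :
  (forall j, exists m : int, [/\ (0 < Q j <= 2 ^ j)%N, coprime (Q j) `|m|%N &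
       `|(Q j)%:R * V - m%:~R * U| <= U / 2 ^+ j]) ->
  forall k y P, (P < 2 ^ k)%N ->
    (visits y P)%:R <= P%:R / U + 6 * \sum_(j < k) 2 ^+ j / (Q j)%:R.
Proof.
move=> QP; have U0 : 0 < U := lt_le_trans ltr01 U1.
elim=> [|k IH] y P Pk.
  by move: Pk; rewrite expn0 ltnS leqn0 => /eqP ->; rewrite /visits big_geq// big_ord0; lra.
have [m [/andP[q0 qk] cop near]] := QP k; set q := Q k in q0 qk cop near *.
have qR : 0 < q%:R :> R by rewrite ltr0n.
have near' : `|q%:R * V - m%:~R * U| <= U / q%:R.
  apply: le_trans near _; rewrite ler_pM2l// lef_pV2 ?posrE ?exprn_gt0//.
  by rewrite -natrX ler_nat.
rewrite big_ord_recr /= -/q (divn_eq P q) visitsD natrD.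
have h1 := visits_mul y (P %/ q) q0 cop near'.
have h2 := IH (y + (P %/ q * q)%:R * V) (P %% q)%N (leq_trans (ltn_pmod P q0) qk).
have h3 : (P %/ q)%:R <= 2 * (2 ^+ k / q%:R) :> R.
  rewrite mulrA ler_pdivlMr// -natrM -exprS -natrX ler_nat.
  exact: leq_trans (leq_trunc_div _ _) (ltnW Pk).
move: h1 h2; move: (visits y _) (visits (y + _) _) => x1 x2 h1 h2.
rewrite natrD natrM; lra.
Qed.

Variables (T : R -> R) (u : R -> nat).
Hypothesis TP : forall x, 0 <= x < 1 ->
  [/\ 0 <= T x < 1, (0 < u x)%N & exists l : int, T x = x + (u x)%:R * V - l%:~R * U].

(** The time that the rotation by [V] needs for [n] steps of its induced map [T]. *)
Definition birkhoff n x : nat := \sum_(i < n) u (iter i T x).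

Lemma iter_unit n x : 0 <= x < 1 -> 0 <= iter n T x < 1.
Proof. by move=> x01; elim: n => //= n /TP[]. Qed.

Lemma iter_birkhoff n x : 0 <= x < 1 ->
  exists l : int, iter n T x = x + (birkhoff n x)%:R * V - l%:~R * U.
Proof.
move=> x01; elim: n => [|n [l IH]].
  by exists 0; rewrite /birkhoff big_ord0 /= !mul0r addr0 subr0.
have [_ _ [l' e]] := TP (iter_unit n x01).
exists (l + l'); rewrite /= e {1}IH /birkhoff big_ord_recr /= natrD intrD; ring.
Qed.

(** Each iterate of [x] lies in [[0, 1)], so it is a visit of the rotation, at the start of a block
    of time of positive length. *)
Lemma leq_visits_birkhoff n x : 0 <= x < 1 -> (n <= visits x (birkhoff n x))%N.
Proof.
move=> x01; elim: n => [//|n IH].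
rewrite {1}/birkhoff big_ord_recr /= -/(birkhoff n x) visitsD -addn1 leq_add//.
have [_ u0 _] := TP (iter_unit n x01).
rewrite /visits big_ltn// mul0r addr0 (_ : hit _ = true)//.
apply/asboolP; have [l e] := iter_birkhoff n x01.
by exists l; rewrite -e; exact: iter_unit.
Qed.

End Visits.

(** * Interval exchanges *)

Section Translation.
Variable R : realType.
Local Notation mR := (measurableTypeR R).
Local Notation mu := (@lebesgue_measure R).

(** By uniqueness of Lebesgue measure: the shifted measure has the same values on half-open
    intervals. *)
Lemma lebesgue_measure_shift (c : R) (B : set mR) : measurable B ->
  mu [set x | B (x + c)] = mu B.
Proof.
move=> mB.
have mf : measurable_fun setT ((fun x => x + c) : mR -> mR) by exact: measurable_funD.
pose nu : {measure set mR -> \bar R} :=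
  @measure_function_pushforward__canonical__measure_function_Measure _ _ _ _ _
    mu (fun x : mR => x + c : mR) mf.
rewrite -[LHS]/(nu B); apply/esym/lebesgue_measure_unique => // X [[a b] _ <-] /=.
have e : [set x | (x + c) \in `]a, b]] = `]a - c, b - c]%classic.
  by apply/seteqP; split=> x /=; rewrite !in_itv /= ltrBlDr lerBrDr.
transitivity (mu `]a - c, b - c]%classic); last by rewrite -e.
rewrite !lebesgue_measure_itv /= !lte_fin ltrD2r.
by case: ifP => // _; rewrite -!EFinD; congr EFin; ring.
Qed.

End Translation.

Section Pieces.
Variables (R : realType) (A : finType) (lam : A -> R) (pos : A -> 'I_#|A|).
Hypotheses (lam_simplex : simplex lam) (pos_bij : bijective pos).
Local Notation L := (left_end lam pos).

(** The row is a parameter, unlike in [in_piece]: with the bottom row this describes the images of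
    the pieces. *)
Definition piece a (x : R) : bool := L a <= x < L a + lam a.

Let lam0 a : 0 < lam a. Proof. by case: lam_simplex. Qed.

Lemma left_end_ge0 a : 0 <= L a.
Proof. by apply: sumr_ge0 => b _; exact: ltW. Qed.

Lemma left_endD a : L a + lam a = \sum_(b | (pos b <= pos a)%N) lam b.
Proof.
rewrite [RHS](bigD1 a)//= addrC; congr (_ + _); apply: eq_bigl => b.
rewrite ltn_neqAle andbC; congr (_ && _).
by rewrite val_eqE (inj_eq (bij_inj pos_bij)).
Qed.

Lemma left_end_le a b : (pos a < pos b)%N -> L a + lam a <= L b.
Proof.
move=> ab; rewrite left_endD /left_end [leRHS](bigID (fun c => (pos c <= pos a)%N))/=.
rewrite -[leLHS]addr0 lerD//; last by apply: sumr_ge0 => c _; exact: ltW.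
rewrite le_eqVlt; apply/orP; left; apply/eqP; apply: eq_bigl => c.
by case: (leqP (pos c) (pos a)) => h; rewrite ?andbF// andbT (leq_ltn_trans h).
Qed.

Lemma piece_unit a x : piece a x -> 0 <= x < 1.
Proof.
move=> /andP[x0 x1]; rewrite (le_trans (left_end_ge0 a) x0) (lt_le_trans x1)//.
rewrite left_endD -lam_simplex.2 [leRHS](bigID (fun b => (pos b <= pos a)%N))/=.
by rewrite lerDl sumr_ge0// => b _; exact: ltW.
Qed.

Lemma piece_inj a b x : piece a x -> piece b x -> a = b.
Proof.
move=> /andP[a0 a1] /andP[b0 b1].
have [h|h|] := ltngtP (pos a) (pos b).
- by have := lt_le_trans a1 (le_trans (left_end_le h) b0); rewrite ltxx.
- by have := lt_le_trans b1 (le_trans (left_end_le h) a0); rewrite ltxx.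
by move=> /val_inj/(bij_inj pos_bij).
Qed.

(** Take the letter at the largest position whose left end does not exceed [x]. Its right end is the
    next left end, or 1 at the last position. *)
Lemma piece_ex x : 0 <= x < 1 -> exists a, piece a x.
Proof.
move=> /andP[x0 x1]; have A0 : (0 < #|A|)%N.
  apply/card_gt0P; have [a _|A0] := pickP [pred a : A | true]; first by exists a.
  have := lam_simplex.2; rewrite big_pred0// => /eqP.
  by rewrite eq_sym oner_eq0.
have [g gK posK] := pos_bij.
pose P k := (k < #|A|)%N && `[< forall a, pos a = k :> nat -> L a <= x >].
have exP : exists k, P k.
  exists 0%N; rewrite /P A0; apply/asboolP => a a0.
  by rewrite /left_end big_pred0// => b; rewrite a0.
have ubP k : P k -> (k <= #|A|)%N by move=> /andP[/ltnW].
have [k /andP[kA /asboolP kx] kmax] := ex_maxnP exP ubP.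
pose a := g (Ordinal kA); have ak : pos a = k :> nat by rewrite posK.
exists a; rewrite /piece (kx a ak) /= ltNge; apply/negP => ax.
have [lastk|nlast] := leqP #|A| k.+1.
  move: x1; rewrite ltNge => /negP; apply; apply: le_trans ax.
  rewrite left_endD -lam_simplex.2 le_eqVlt; apply/orP; left; apply/eqP.
  by apply: eq_bigl => b; rewrite ak -ltnS (leq_trans (ltn_ord _) lastk).
have : P k.+1.
  rewrite /P nlast; apply/asboolP => b bk; apply: le_trans ax.
  rewrite left_endD le_eqVlt; apply/orP; left; apply/eqP.
  by apply: eq_bigl => c; rewrite bk ak ltnS.
by move/kmax; rewrite ltnn.
Qed.

End Pieces.

Section IntervalExchange.
Variables (R : realType) (A : finType) (p : iet_perm A) (lam : A -> R).
Hypothesis lam_simplex : simplex lam.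
Local Notation mR := (measurableTypeR R).
Local Notation mu := (@lebesgue_measure R).
Local Notation T := (iet p lam).
Local Notation top := (top_pos p).
Local Notation bot := (bot_pos p).

Let shift a : R := left_end lam bot a - left_end lam top a.

Lemma ietE a x : piece lam top a x -> T x = x + shift a.
Proof.
move=> ax; rewrite /iet; case: pickP => [b bx|/(_ a)]; last by rewrite /in_piece -/(piece _ _ _ _) ax.
by rewrite (piece_inj lam_simplex (top_pos_bij p) bx ax) /shift; ring.
Qed.

Lemma piece_shift a x : piece lam top a x = piece lam bot a (x + shift a).
Proof. by rewrite /piece /shift; apply/idP/idP; lra. Qed.

Lemma iet_unit x : 0 <= x < 1 -> 0 <= T x < 1.
Proof.
move=> /(piece_ex lam_simplex (top_pos_bij p))[a ax].
rewrite (ietE ax); apply: (piece_unit lam_simplex (bot_pos_bij p) (a := a)).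
by rewrite -piece_shift.
Qed.

Lemma measurable_piece (pos : A -> 'I_#|A|) a :
  measurable ([set x | piece lam pos a x] : set mR).
Proof.
rewrite (_ : [set x | _] = `[left_end lam pos a, left_end lam pos a + lam a[%classic).
  exact: measurable_itv.
by apply/seteqP; split=> x; rewrite /= in_itv.
Qed.

Lemma measurable_iet : measurable_fun setT (T : mR -> mR).
Proof.
(* The formula holds on the whole line: outside [[0, 1)] every indicator vanishes and [T] is the
   identity by its default value. *)
rewrite (_ : T = fun x => x + \sum_a shift a * \1_[set x | piece lam top a x] x).
  apply: measurable_funD => //; apply: measurable_sum => a.
  by apply: measurable_funM => //; apply: measurable_indic; exact: measurable_piece.
apply/funext => x; have [[a ax]|nx] := pselect (exists a, piece lam top a x).
  rewrite (ietE ax) (bigD1 a)//= indicE mem_set// mulr1 big1 ?addr0// => b ba.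
  rewrite indicE memNset ?mulr0// => bx; move/eqP: ba; apply.
  exact: (piece_inj lam_simplex (top_pos_bij p) (bx : piece lam top b x) ax).
rewrite big1 ?addr0 => [|a _].
  rewrite /iet; case: pickP => // a ax; exfalso; apply: nx; exists a; exact: ax.
by rewrite indicE memNset ?mulr0// => ax; apply: nx; exists a.
Qed.

Lemma measurable_iter_iet n : measurable_fun setT (iter n T : mR -> mR).
Proof.
elim: n => [|n IH]; first exact: measurable_id.
exact: (measurableT_comp measurable_iet IH).
Qed.

Lemma measure_pieces (pos : A -> 'I_#|A|) (B : set mR) : bijective pos -> measurable B ->
  mu (unit_co `&` B) = (\sum_a mu ([set x | piece lam pos a x] `&` B))%E.
Proof.
move=> bpos mB.
have -> : unit_co `&` B = \bigcup_(a in [set: A]) ([set x | piece lam pos a x] `&` B).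
  rewrite -setI_bigcupl; congr (_ `&` _); apply/seteqP; split=> x.
    by rewrite /unit_co /= in_itv => /(piece_ex lam_simplex bpos)[a ax]; exists a.
  by move=> [a _ /(piece_unit lam_simplex bpos)]; rewrite /unit_co /= in_itv.
rewrite measure_fin_bigcup//.
- rewrite (fsbigE (index_enum A)) ?index_enum_uniq//; last by move=> a _; rewrite mem_index_enum.
  by apply: eq_bigl => a; rewrite in_setT.
- exact: finite_finset.
- by move=> a b _ _ [x [[ax _] [bx _]]]; exact: (piece_inj lam_simplex bpos ax bx).
- by move=> a _; apply: measurableI => //; exact: measurable_piece.
Qed.

(** Cut the left side along the top pieces and the right side along the bottom ones. Corresponding
    pieces differ by a translation. *)
Lemma iet_measure_preserving (B : set mR) : measurable B ->
  mu (unit_co `&` T @^-1` B) = mu (unit_co `&` B).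
Proof.
move=> mB; have mTB : measurable (T @^-1` B).
  by rewrite -[X in measurable X]setTI; exact: measurable_iet.
rewrite (measure_pieces (top_pos_bij p) mTB) (measure_pieces (bot_pos_bij p) mB).
apply: eq_bigr => a _; rewrite -[in RHS](lebesgue_measure_shift (shift a)); last first.
  by apply: measurableI => //; exact: measurable_piece.
congr mu; apply/seteqP; split=> x /=; rewrite -piece_shift.
  by move=> [ax]; rewrite (ietE ax).
by move=> [ax Bx]; rewrite (ietE ax).
Qed.

Lemma iter_iet_measure_preserving n (B : set mR) : measurable B ->
  mu (unit_co `&` iter n T @^-1` B) = mu (unit_co `&` B).
Proof.
elim: n B => [//|n IH] B mB.
have mTB : measurable (T @^-1` B).
  by rewrite -[X in measurable X]setTI; exact: measurable_iet.
by rewrite -(iet_measure_preserving mB) -(IH _ mTB).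
Qed.

(** The difference of the two left ends of [a] is row [a] of [omega] applied to [lam], into which
    the wedge form is substituted. *)
Lemma iet_translation (u v : A -> int) : wedge_form top bot u v ->
  forall a x, piece lam top a x ->
  T x = x + (u a)%:~R * lin_form v lam - (v a)%:~R * lin_form u lam.
Proof.
move=> [_ w] a x ax; rewrite (ietE ax) -addrA; congr (_ + _).
rewrite /shift /left_end big_mkcond [X in _ - X]big_mkcond /lin_form !mulr_sumr -!sumrB.
apply: eq_bigr => b _; rewrite !mulrA -mulrBl -!intrM -intrB -w /omega intrB.
by case: ifP => _; case: ifP => _ /=; rewrite ?(subr0, sub0r, mul1r, mulN1r, mul0r, subrr).
Qed.

End IntervalExchange.

(** * Correlations of tent functions *)

Section Signs.
Variable R : realType.

Definition is_sign (e : nat -> R) := forall i, e i = 1 \/ e i = -1.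

(* Adding [v] or [- v], whichever makes the cross term nonnegative, increases the
   squared norm by at least that of [v]. *)
Lemma exists_signs (I : finType) (n : nat) (v : nat -> I -> R) :
  exists2 e, is_sign e &
    \sum_x \sum_(i < n) v i x ^+ 2 <= \sum_x (\sum_(i < n) e i * v i x) ^+ 2.
Proof.
elim: n => [|n [e es IH]].
  exists (fun=> 1); first by left.
  by apply: ler_sum => x _; rewrite !big_ord0 expr0n.
pose s x := \sum_(i < n) e i * v i x.
pose c := \sum_x s x * v n x.
pose en : R := if 0 <= c then 1 else -1.
have en2 : en ^+ 2 = 1 by rewrite /en; case: ifP; rewrite ?sqrrN expr1n.
have enc : 0 <= en * c.
  by rewrite /en; case: ifPn; rewrite ?mul1r// -ltNge mulN1r oppr_ge0 => /ltW.
exists (fun i => if i == n then en else e i).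
  by move=> i; case: eqP => // _; rewrite /en; case: ifP; [left|right].
have sE x : \sum_(i < n.+1) (if i == n :> nat then en else e i) * v i x = s x + en * v n x.
  rewrite big_ord_recr /= eqxx; congr (_ + _); apply: eq_bigr => i _.
  by rewrite ltn_eqF.
under eq_bigr do rewrite big_ord_recr /=.
under [leRHS]eq_bigr do rewrite sE.
have -> : \sum_x (s x + en * v n x) ^+ 2 =
    \sum_x (s x) ^+ 2 + 2 * (en * c) + \sum_x v n x ^+ 2.
  rewrite /c !mulr_sumr -!big_split /=; apply: eq_bigr => x _.
  by rewrite sqrrD exprMn en2 mul1r; ring.
rewrite big_split /= lerD2r; apply: le_trans IH _.
by rewrite lerDl mulr_ge0.
Qed.

(** Two applications: first signs for [i], with the vectors indexed by the pairs [(n, j)], then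
    signs for [j] once the sums over [i] are fixed. *)
Lemma exists_signs2 (N L : nat) (a : nat -> nat -> nat -> R) :
  exists e e', [/\ is_sign e, is_sign e' &
    \sum_(n < N) \sum_(i < L) \sum_(j < L) a n i j ^+ 2 <=
    \sum_(n < N) (\sum_(i < L) \sum_(j < L) e i * e' j * a n i j) ^+ 2].
Proof.
have [e es h] := @exists_signs ('I_N * 'I_L)%type L (fun i x => a x.1 i x.2).
have [e' es' h'] := @exists_signs 'I_N L (fun j n => \sum_(i < L) e i * a n i j).
exists e, e'; split=> //; apply: le_trans (le_trans h' _).
  apply: le_trans (le_trans h _).
    rewrite -(pair_bigA _ (fun (n : 'I_N) (j : 'I_L) => \sum_(i < L) a n i j ^+ 2)) /=.
    by apply: ler_sum => n _; rewrite exchange_big.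
  by rewrite -(pair_bigA _ (fun (n : 'I_N) (j : 'I_L) => (\sum_(i < L) e i * a n i j) ^+ 2)).
apply: ler_sum => n _; rewrite le_eqVlt; apply/orP; left; apply/eqP; congr (_ ^+ 2).
rewrite exchange_big /=; apply: eq_bigr => i _; rewrite mulr_sumr.
by apply: eq_bigr => j _; ring.
Qed.

End Signs.

Section Tents.
Variables (R : realType) (L : nat).
Hypothesis L0 : (0 < L)%N.
Local Notation w := (L%:R^-1 : R).

(** Slope 1 on the [i]-th of [L] cells, for every [L]: the disjoint supports then keep the Lipschitz
    norm of any signed combination bounded. *)
Definition tent (i : nat) (y : R) : R :=
  Num.max 0 (w / 2 - `|y - (i%:R + 2^-1) * w|).

Let w0 : 0 < w. Proof. by rewrite invr_gt0 ltr0n. Qed.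

Lemma tent_ge0 i y : 0 <= tent i y.
Proof. by rewrite /tent le_max lexx. Qed.

Lemma tent_le i y : tent i y <= w / 2.
Proof.
rewrite /tent ge_max; apply/andP; split; first by rewrite mulr_ge0 ?ltW.
by rewrite gerBl.
Qed.

Lemma tent_support i y : tent i y != 0 -> i%:R < L%:R * y < i%:R + 1.
Proof.
rewrite /tent; case: (ltP 0 (w / 2 - _)) => [h _|_]; last by rewrite eqxx.
have LR : 0 < L%:R :> R by rewrite ltr0n.
have yw : L%:R * y * w = y by rewrite mulrAC divff ?mul1r// gt_eqF.
move: h; rewrite subr_gt0 ltr_norml => /andP[h1 h2].
by apply/andP; split; rewrite -(ltr_pM2r w0) yw; lra.
Qed.

Lemma tent_inj i j y : tent i y != 0 -> tent j y != 0 -> i = j.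
Proof.
move=> /tent_support/andP[i1 i2] /tent_support/andP[j1 j2].
have : (i < j.+1)%N by rewrite -(ltr_nat R) -[j.+1]addn1 natrD; lra.
have : (j < i.+1)%N by rewrite -(ltr_nat R) -[i.+1]addn1 natrD; lra.
lia.
Qed.

Lemma tent_lip i x y : `|tent i x - tent i y| <= `|x - y|.
Proof.
rewrite /tent; set c := (_ + _) * w.
have h1 := ler_dist_dist (x - c) (y - c).
have e : x - c - (y - c) = x - y by ring.
rewrite e ler_norml in h1; move/andP: h1 => [h1 h2].
have h3 := normr_ge0 (x - y).
by case: (ltP 0 (w / 2 - `|x - c|)) => ?; case: (ltP 0 (w / 2 - `|y - c|)) => ?;
  rewrite ler_norml; lra.
Qed.

Lemma measurable_tent i : measurable_fun setT (tent i : measurableTypeR R -> measurableTypeR R).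
Proof.
apply: measurable_maxr => //; apply: measurable_funB => //.
by apply: measurableT_comp => //; apply: measurable_funB.
Qed.

Definition tent_comb (e : nat -> R) (y : R) : R := \sum_(i < L) e i * tent i y.

Lemma tent_combE e y (i : 'I_L) : tent i y != 0 -> tent_comb e y = e i * tent i y.
Proof.
move=> iy; rewrite /tent_comb (bigD1 i)//= big1 ?addr0// => j /eqP ji.
have [->|jy] := eqVneq (tent j y) 0; first by rewrite mulr0.
by case: ji; apply: val_inj; exact: tent_inj jy iy.
Qed.

Lemma tent_comb0 e y : (forall i : 'I_L, tent i y = 0) -> tent_comb e y = 0.
Proof. by move=> y0; rewrite /tent_comb big1// => i _; rewrite y0 mulr0. Qed.

Variable e : nat -> R.
Hypothesis e_sign : is_sign e.

Let norm_sign i : `|e i| = 1.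
Proof. by case: (e_sign i) => ->; rewrite ?normrN normr1. Qed.

Lemma norm_tent_comb y : `|tent_comb e y| <= 1.
Proof.
have w1 : w <= 1 by rewrite invf_le1 ?ler1n ?ltr0n.
have [[i iy]|ny] := pselect (exists i : 'I_L, tent i y != 0).
  rewrite (tent_combE e iy) normrM norm_sign mul1r ger0_norm ?tent_ge0//.
  by apply: le_trans (tent_le _ _) _; lra.
rewrite tent_comb0 ?normr0// => i; apply/eqP; apply: contraT => h.
by exfalso; apply: ny; exists i.
Qed.

(** At most two tents are nonzero at [x] or at [y], and each changes by at most [|x - y|]. *)
Lemma tent_comb_lip x y : `|tent_comb e x - tent_comb e y| <= 2 * `|x - y|.
Proof.
have single z : `|tent_comb e z - tent_comb e z| <= 2 * `|x - y|.
  by rewrite subrr normr0 mulr_ge0.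
have half z t (i : 'I_L) : tent i z != 0 -> `|e i * tent i z - e i * tent i t| <= `|z - t|.
  by move=> iz; rewrite -mulrBr normrM norm_sign mul1r tent_lip.
have zero z t (i : 'I_L) : tent i z != 0 -> tent i t = 0 -> `|e i * tent i z| <= `|z - t|.
  by move=> iz it; have := half z t i iz; rewrite it mulr0 subr0.
have none z : ~ (exists i : 'I_L, tent i z != 0) -> forall i : 'I_L, tent i z = 0.
  by move=> nz i; apply/eqP; apply: contraT => h; exfalso; apply: nz; exists i.
have xy0 := normr_ge0 (x - y).
have [[i ix]|/none nx] := pselect (exists i : 'I_L, tent i x != 0);
have [[j jy]|/none ny] := pselect (exists i : 'I_L, tent i y != 0).
- rewrite (tent_combE e ix) (tent_combE e jy).
  have [ij|ij] := eqVneq i j.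
    by subst j; apply: le_trans (half _ _ _ ix) _; lra.
  have iy : tent i y = 0.
    apply/eqP; apply: contraT => h; move/eqP: ij; case; apply: val_inj.
    exact: tent_inj h jy.
  have jx : tent j x = 0.
    apply/eqP; apply: contraT => h; move/eqP: ij; case; apply: val_inj.
    exact: tent_inj ix h.
  apply: le_trans (ler_normB _ _) _.
  have := zero _ _ _ ix iy; have := zero _ _ _ jy jx; rewrite (distrC y x); lra.
- rewrite (tent_combE e ix) (tent_comb0 _ ny) subr0.
  by have := zero _ _ _ ix (ny i); lra.
- rewrite (tent_combE e jy) (tent_comb0 _ nx) sub0r normrN.
  by have := zero _ _ _ jy (nx j); rewrite (distrC y x); lra.
- by rewrite !tent_comb0// subrr normr0; lra.
Qed.

Lemma tent_comb_neq0 : exists2 x, unit_co x & tent_comb e x != 0.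
Proof.
exists (w / 2).
  rewrite /unit_co /= in_itv /=.
  have w1 : w <= 1 by rewrite invf_le1 ?ler1n ?ltr0n.
  by have := w0; lra.
have t0 : tent 0 (w / 2) != 0.
  rewrite /tent add0r [2^-1 * w]mulrC subrr normr0 subr0.
  have h : 0 < w / 2 by rewrite divr_gt0.
  by rewrite max_r ?(ltW h)// gt_eqF.
rewrite (tent_combE e (i := Ordinal L0) t0) mulf_neq0//.
by rewrite -normr_eq0 norm_sign oner_eq0.
Qed.

Lemma tent_comb_lipschitz :
  [lipschitz (tent_comb e : R^o -> R^o) x | x in unit_co].
Proof.
exists 2; split=> // k k2 [x y] /= _.
by apply: le_trans (tent_comb_lip _ _) _; rewrite ler_wpM2r// ltW.
Qed.

Lemma lip_norm_tent_comb : 0 <= lip_norm (tent_comb e) <= 3.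
Proof.
have ub : ubound [set `|tent_comb e x| | x in unit_co] 1.
  by move=> _ [x _ <-]; exact: norm_tent_comb.
have u0 : unit_co (0 : R) by rewrite /unit_co /= in_itv /= lexx ltr01.
have s1 : sup_norm (tent_comb e) <= 1.
  apply: ge_sup => //; by exists `|tent_comb e 0|, 0.
have s0 : 0 <= sup_norm (tent_comb e).
  apply: le_trans (normr_ge0 (tent_comb e 0)) _.
  by apply: ub_le_sup; [exists 1 | exists 0].
set B := [set k : R | 0 <= k /\ k.-lipschitz_unit_co (tent_comb e : R^o -> R^o)].
have B2 : B 2 by split=> // -[x y] /= _; exact: tent_comb_lip.
have lb : lbound B 0 by move=> k [].
have i2 : best_lip (tent_comb e) <= 2 by apply: ge_inf => //; exists 0.
have i0 : 0 <= best_lip (tent_comb e) by apply: lb_le_inf => //; exists 2.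
by rewrite /lip_norm; lra.
Qed.

End Tents.

(** * Integration over the unit interval *)

Section IntegralUnit.
Variable R : realType.
Local Notation mR := (measurableTypeR R).
Local Notation mu := (@lebesgue_measure R).
Implicit Types (f g : R -> R) (c : R).

Definition bounded_measurable f : Prop :=
  measurable_fun setT (f : mR -> mR) /\
  exists C, forall x, unit_co x -> `|f x| <= C.

Lemma measurable_unit_co : measurable (unit_co : set mR).
Proof. exact: measurable_itv. Qed.

Lemma lebesgue_unit_co : mu unit_co = 1%E.
Proof. by rewrite lebesgue_measure_itv /= lte_fin ltr01 oppr0 adde0. Qed.

Lemma bounded_measurable_integrable f : bounded_measurable f ->
  mu.-integrable unit_co (EFin \o f).
Proof.
move=> [mf [C fC]]; apply: measurable_bounded_integrable.
- exact: measurable_unit_co.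
- by have /= -> := lebesgue_unit_co; rewrite ltry.
- exact: measurable_funTS.
- exists `|C|; split; first exact: normr_real.
  move=> M CM x /fC fx; apply: le_trans fx _; apply: le_trans (ler_norm C) _.
  exact: ltW.
Qed.

Lemma bounded_measurableM f g : bounded_measurable f -> bounded_measurable g ->
  bounded_measurable (fun x => f x * g x).
Proof.
move=> [mf [C fC]] [mg [D gD]]; split; first exact: measurable_funM.
by exists (C * D) => x ux; rewrite normrM ler_pM// ?fC ?gD.
Qed.

Lemma bounded_measurable_cst c : bounded_measurable (fun=> c).
Proof. by split; [exact: measurable_cst | exists `|c|]. Qed.

Lemma bounded_measurableD f g : bounded_measurable f -> bounded_measurable g ->
  bounded_measurable (fun x => f x + g x).
Proof.
move=> [mf [C fC]] [mg [D gD]]; split; first exact: measurable_funD.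
exists (C + D) => x ux; apply: le_trans (ler_normD _ _) _.
by rewrite lerD ?fC ?gD.
Qed.

Lemma bounded_measurable_indic (B : set mR) : measurable B -> bounded_measurable \1_B.
Proof.
move=> mB; split; first exact: measurable_indic.
by exists 1 => x _; rewrite indicE; case: (_ \in _); rewrite ?normr1 ?normr0.
Qed.

Lemma integral_co_le f g : bounded_measurable f -> bounded_measurable g ->
  (forall x, unit_co x -> f x <= g x) -> integral_co f <= integral_co g.
Proof.
move=> bf bg fg; apply: (@le_Rintegral _ mR _ mu unit_co f g) => //.
  exact: measurable_unit_co.
  exact: bounded_measurable_integrable.
exact: bounded_measurable_integrable.
Qed.

Lemma eq_integral_co f g : (forall x, unit_co x -> f x = g x) ->
  integral_co f = integral_co g.
Proof. by move=> fg; apply: eq_Rintegral => x; rewrite inE => /fg. Qed.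

Lemma integral_coD f g : bounded_measurable f -> bounded_measurable g ->
  integral_co (fun x => f x + g x) = integral_co f + integral_co g.
Proof.
move=> bf bg; apply: (@RintegralD _ mR _ mu unit_co f g); first exact: measurable_unit_co.
  exact: bounded_measurable_integrable.
exact: bounded_measurable_integrable.
Qed.

Lemma integral_coZ c f : bounded_measurable f ->
  integral_co (fun x => c * f x) = c * integral_co f.
Proof.
move=> bf; apply: (@RintegralZl _ mR _ mu unit_co f c); first exact: measurable_unit_co.
exact: bounded_measurable_integrable.
Qed.

Lemma integral_co_cst c : integral_co (fun=> c) = c.
Proof.
rewrite /integral_co Rintegral_cst; last exact: measurable_unit_co.
by have /= -> := lebesgue_unit_co; rewrite mulr1.
Qed.

Lemma integral_co_indic (B : set mR) : measurable B ->
  integral_co \1_B = fine (mu (unit_co `&` B)).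
Proof.
move=> mB; rewrite /integral_co /Rintegral; congr fine.
by have /= -> := integral_indic mu measurable_unit_co mB; rewrite setIC.
Qed.

Lemma bounded_measurable_sum I (r : seq I) (P : pred I) (F : I -> R -> R) :
  (forall i, bounded_measurable (F i)) ->
  bounded_measurable (fun x => \sum_(i <- r | P i) F i x).
Proof.
move=> bF; elim: r => [|i r IH].
  by under eq_fun do rewrite big_nil; exact: bounded_measurable_cst.
under eq_fun do rewrite big_cons; case: (P i) => //.
exact: bounded_measurableD.
Qed.

Lemma integral_co_sum I (r : seq I) (P : pred I) (F : I -> R -> R) :
  (forall i, bounded_measurable (F i)) ->
  integral_co (fun x => \sum_(i <- r | P i) F i x) =
  \sum_(i <- r | P i) integral_co (F i).
Proof.
move=> bF; elim: r => [|i r IH].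
  by under eq_integral_co do rewrite big_nil; rewrite integral_co_cst big_nil.
under eq_integral_co do rewrite big_cons; rewrite big_cons; case: (P i) => //.
by rewrite integral_coD ?IH//; exact: bounded_measurable_sum.
Qed.

Section TentIntegral.
Variable L : nat.
Hypothesis L0 : (0 < L)%N.

Lemma bounded_measurable_tent i : bounded_measurable (tent L i : R -> R).
Proof.
split; first exact: measurable_tent.
by exists (L%:R^-1 / 2) => x _; rewrite ger0_norm ?tent_ge0 ?tent_le.
Qed.

(** On the middle half of its cell, of length [w / 2], the tent is at least [w / 4]. *)
Lemma integral_tent_ge i : (i < L)%N -> (L%:R^-1 : R) ^+ 2 / 8 <= integral_co (tent L i : R -> R).
Proof.
move=> iL; set w := L%:R^-1 : R.
have LR : 0 < L%:R :> R by rewrite ltr0n.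
have w0 : 0 < w by rewrite invr_gt0.
have iw : i%:R * w + w <= 1.
  by rewrite -[X in _ + X]mul1r -mulrDl ler_pdivrMr// mul1r natr1 ler_nat.
have iw0 : 0 <= i%:R * w by rewrite mulr_ge0// ltW.
pose J : set mR := `[(i%:R + 4^-1) * w, (i%:R + 3 / 4) * w]%classic.
have mJ : measurable J by exact: measurable_itv.
have -> : w ^+ 2 / 8 = integral_co (fun x => (w / 4) * \1_J x).
  rewrite integral_coZ; last exact: bounded_measurable_indic.
  rewrite integral_co_indic//.
  have -> : unit_co `&` J = J.
    apply/setIidPr => x; rewrite /J /unit_co /= !in_itv /= => /andP[x1 x2].
    by apply/andP; split; lra.
  rewrite /J lebesgue_measure_itv /= lte_fin ifT; last lra.
  by rewrite -EFinB /=; field.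
apply: integral_co_le.
- apply: bounded_measurableM; first exact: bounded_measurable_cst.
  exact: bounded_measurable_indic.
- exact: bounded_measurable_tent.
move=> x _; rewrite indicE; case: (boolP (x \in J)); last by rewrite mulr0 tent_ge0.
rewrite inE /J /= in_itv /= => /andP[x1 x2].
rewrite mulr1 /tent le_max -/w; apply/orP; right.
have : `|x - (i%:R + 2^-1) * w| <= w / 4 by rewrite ler_norml; lra.
lra.
Qed.

End TentIntegral.

End IntegralUnit.

(** Lets a rounding be recorded by one boolean when the possible target cells are counted. *)
Lemma int_near_floor (R : realType) (z : int) (c : R) :
  c - 1 < z%:~R < c + 1 -> exists e : bool, z = Num.floor c + (e : nat)%:Z.
Proof.
move=> /andP[z1 z2]; have := floor_itv c; rewrite intrD => /andP[f1 f2].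
have l1 : Num.floor c <= z by rewrite -ltzD1 -(ltr_int R) intrD; lra.
have l2 : z < Num.floor c + 2 by rewrite -(ltr_int R) intrD; lra.
have [->|ne] := eqVneq z (Num.floor c); first by exists false; rewrite addr0.
exists true; move/eqP: ne; lia.
Qed.

(** * Correlations at one time: [S] is an iterate of the exchange, [h] its Birkhoff sum, [c0] the
    mean of [h] *)

Section OneTime.
Variables (R : realType) (U V c0 : R) (S : R -> R) (h : R -> nat) (M : nat).
Local Notation mR := (measurableTypeR R).
Local Notation mu := (@lebesgue_measure R).
Hypothesis U1 : 1 <= U.
Hypothesis mS : measurable_fun setT (S : mR -> mR).
Hypothesis S_unit : forall x, 0 <= x < 1 -> 0 <= S x < 1.
Hypothesis bh : bounded_measurable (fun x => (h x)%:R : R).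
Hypothesis SP : forall x, 0 <= x < 1 ->
  exists l : int, S x = x + (h x)%:R * V - l%:~R * U.
Hypothesis c0_ge0 : 0 <= c0.
Hypothesis M0 : (0 < M)%N.
Hypothesis h_ge : forall x, 0 <= x < 1 -> c0 - M%:R <= (h x)%:R.
Hypothesis h_int : integral_co (fun x => (h x)%:R) = c0.

(** [K] bounds the number of integers from [c0 - M] up to, but excluding, [c0 + 31 M]. With
    [L = 16 K], the at most [4 K L] touched pairs of cells are a quarter of all [L ^ 2] pairs. *)
Let K := (32 * M + 1)%N.
Let L := (16 * K)%N.
Let L0 : (0 < L)%N. Proof. by rewrite /L /K; lia. Qed.
Local Notation w := (L%:R^-1 : R).

Let late : set mR := [set x | c0 + 31 * M%:R <= (h x)%:R].

Let measurable_late : measurable late.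
Proof.
rewrite -[X in measurable X]setTI.
exact: (measurable_fun_le measurableT (measurable_cst (c0 + 31 * M%:R)) bh.1).
Qed.

(** Markov's inequality for [h - c0 + M], which is nonnegative, has mean [M], and is at least [32 M]
    on [late]. *)
Let integral_late : integral_co \1_late <= 32^-1.
Proof.
have MR : 0 < M%:R :> R by rewrite ltr0n.
have bl := bounded_measurable_indic measurable_late.
have : integral_co (fun x => (32 * M%:R) * \1_late x) <=
       integral_co (fun x => (h x)%:R + (M%:R - c0)).
  apply: integral_co_le.
  - by apply: bounded_measurableM => //; exact: bounded_measurable_cst.
  - by apply: bounded_measurableD => //; exact: bounded_measurable_cst.
  move=> x; rewrite /unit_co /= in_itv /= => /h_ge hx.
  rewrite indicE; case: (boolP (x \in late)) => [|_]; last by rewrite mulr0; lra.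
  by rewrite inE /late /= mulr1; lra.
rewrite integral_coZ// integral_coD//; last exact: bounded_measurable_cst.
rewrite h_int integral_co_cst => le1.
have : 32 * M%:R * integral_co \1_late <= M%:R by lra.
by rewrite [32 * _]mulrC -mulrA ger_pMr// => ?; lra.
Qed.

Let touch (i j : nat) : bool :=
  `[< exists2 x, 0 <= x < 1 /\ ~ late x & tent L i (S x) * tent L j x != 0 >].

(** The cell reached from cell [j]: [k] encodes the value of [h], counted from [Num.truncn c0 - M],
    while [e1] and [e2] are the rounding bits for the multiple of [U] and for the cell. *)
Let position (j k : nat) (e1 e2 : bool) : int :=
  let c := (k%:Z + (Num.truncn c0)%:Z - M%:Z)%:~R * V in
  j%:Z + Num.floor (L%:R * (c - (Num.floor (c / U) + (e1 : nat)%:Z)%:~R * U))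
  + (e2 : nat)%:Z.

(** Outside [late], [h] takes at most [K] values. Given [h], the multiple of [U] has two possible
    values because [|S x - x| < 1 <= U]. Then [i - j] is within 1 of [L (S x - x)], which leaves two
    choices again. *)
Let touch_position i j : touch i j ->
  exists k : 'I_K, exists e1 e2 : bool, i%:Z = position j k e1 e2.
Proof.
move=> /asboolP[x [x01 nlate]]; rewrite mulf_eq0 negb_or => /andP[ti tj].
have [l Sx] := SP x01; have /andP[S0 S1] := S_unit x01; have /andP[x0 x1] := x01.
have LR : 0 < L%:R :> R by rewrite ltr0n.
have /andP[i1 i2] := tent_support L0 ti; have /andP[j1 j2] := tent_support L0 tj.
have hx1 := h_ge x01; have hx2 : (h x)%:R < c0 + 31 * M%:R by rewrite ltNge; exact/negP.
have /andP[t1 t2] := truncn_itv c0_ge0; rewrite -natr1 in t2.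
have kge : (Num.truncn c0 <= h x + M)%N by rewrite -(ler_nat R) natrD; lra.
have klt : (h x + M - Num.truncn c0 < K)%N.
  rewrite -(ltr_nat R) natrB// natrD /K natrD natrM; lra.
exists (Ordinal klt) => /=.
have kE : (h x + M - Num.truncn c0)%N%:Z + (Num.truncn c0)%:Z - M%:Z = h x.
  by rewrite -subzn// PoszD; ring.
rewrite /position kE -pmulrn; set c := (h x)%:R * V in Sx *.
have U0 : 0 < U by exact: lt_le_trans ltr01 U1.
have [|e1 lE] := @int_near_floor R l (c / U).
  have e : c / U - l%:~R = (S x - x) / U by rewrite Sx; field; rewrite gt_eqF.
  have : `|(S x - x) / U| < 1.
    rewrite normrM [`|U^-1|]gtr0_norm ?invr_gt0// ltr_pdivrMr// mul1r ltr_norml.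
    by have := U1; lra.
  by rewrite -e ltr_norml; lra.
have [|e2 iE] := @int_near_floor R (i%:Z - j%:Z) (L%:R * (c - l%:~R * U)).
  have -> : L%:R * (c - l%:~R * U) = L%:R * S x - L%:R * x by rewrite Sx; ring.
  by rewrite intrB -!pmulrn; lra.
by exists e1, e2; rewrite -lE -addrA -iE addrC subrK.
Qed.

Let touched := [set ij : 'I_L * 'I_L | touch ij.1 ij.2]%SET.

Let card_touched : (#|touched| <= L * (K * 4))%N.
Proof.
have ex (ij : 'I_L * 'I_L) : exists t : 'I_K * (bool * bool),
    touch ij.1 ij.2 -> (ij.1 : nat)%:Z = position ij.2 t.1 t.2.1 t.2.2.
  have [/touch_position[k [e1 [e2 e]]]|nt] := boolP (touch ij.1 ij.2).
    by exists (k, (e1, e2)).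
  have K0 : (0 < K)%N by rewrite /K; lia.
  by exists (Ordinal K0, (true, true)).
pose t (ij : 'I_L * 'I_L) := projT1 (cid (ex ij)).
have tP (ij : 'I_L * 'I_L) : touch ij.1 ij.2 -> (ij.1 : nat)%:Z = position ij.2 (t ij).1 (t ij).2.1 (t ij).2.2.
  exact: projT2 (cid (ex ij)).
have inj : {in touched &, injective (fun ij => (ij.2, t ij))}.
  move=> [i j] [i' j'] h1 h2 [jj tt]; rewrite inE in h1; rewrite inE in h2.
  have := tP _ h1; have := tP _ h2; rewrite /= tt jj => <- /eqP.
  by rewrite eqz_nat => /eqP/val_inj ->.
rewrite -(card_in_imset inj); apply: leq_trans (max_card _) _.
by rewrite !card_prod !card_ord card_bool.
Qed.

Let corr i j : R := integral_co (fun y => tent L i (S y) * tent L j y).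
Let mean i : R := integral_co (tent L i : R -> R).

Let bounded_corr i j : bounded_measurable (fun y => tent L i (S y) * tent L j y).
Proof.
apply: bounded_measurableM; last exact: bounded_measurable_tent.
split; first exact: (measurableT_comp (f := tent L i : mR -> mR) (@measurable_tent R L i) mS).
by exists (w / 2) => x _; rewrite ger0_norm ?tent_ge0 ?tent_le.
Qed.

Let sum_tent_le y : \sum_(i < L) tent L i y <= w / 2.
Proof.
have [[i iy]|ny] := pselect (exists i : 'I_L, tent L i y != 0).
  rewrite (bigD1 i)//= big1 ?addr0 ?tent_le// => j /eqP ji.
  apply/eqP; apply: contraT => jy; case: ji; apply: val_inj.
  exact: tent_inj jy iy.
rewrite big1 => [|i _]; first by rewrite mulr_ge0// invr_ge0.
by apply/eqP; apply: contraT => h1; exfalso; apply: ny; exists i.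
Qed.

(** Untouched pairs correlate only through [late], of measure at most 1/32, where the products of
    tents sum to at most [(w / 2) ^ 2]. *)
Let sum_untouched_corr :
  \sum_(ij : 'I_L * 'I_L | ij \notin touched) corr ij.1 ij.2 <= w ^+ 2 / 128.
Proof.
rewrite /corr.
rewrite -(@integral_co_sum R _ _ _
    (fun (ij : 'I_L * 'I_L) y => tent L ij.1 (S y) * tent L ij.2 y)); last first.
  by move=> ij; exact: bounded_corr.
have bl := bounded_measurable_indic measurable_late.
apply: le_trans (_ : integral_co (fun y => (w / 2) ^+ 2 * \1_late y) <= _).
  apply: integral_co_le.
  - by apply: bounded_measurable_sum => ij; exact: bounded_corr.
  - by apply: bounded_measurableM => //; exact: bounded_measurable_cst.
  move=> y; rewrite /unit_co /= in_itv /= => y01.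
  rewrite indicE; case: (boolP (y \in late)) => [_|nl].
    rewrite mulr1; apply: le_trans (_ : \sum_(ij : 'I_L * 'I_L) tent L ij.1 (S y) * tent L ij.2 y <= _).
      rewrite [leRHS](bigID (fun ij => ij \notin touched))/= lerDl.
      by apply: sumr_ge0 => ij _; rewrite mulr_ge0// tent_ge0.
    rewrite -(pair_bigA _ (fun i j : 'I_L => tent L i (S y) * tent L j y)) /=.
    under eq_bigr do rewrite -mulr_sumr.
    rewrite -mulr_suml expr2; apply: ler_pM; rewrite ?sum_tent_le//.
      by apply: sumr_ge0 => i _; exact: tent_ge0.
    by apply: sumr_ge0 => i _; exact: tent_ge0.
  rewrite mulr0 big1// => ij; rewrite inE => nt; apply/eqP; apply: contraT => h1.
  move/asboolP: nt; case; exists y => //; split=> //.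
  by move: nl; rewrite notin_setE.
rewrite integral_coZ//.
apply: le_trans (_ : (w / 2) ^+ 2 * 32^-1 <= _).
  by rewrite ler_wpM2l// exprn_ge0// mulr_ge0// invr_ge0.
by rewrite expr2; lra.
Qed.

(** At least [3/4 L ^ 2] pairs are untouched, so their products of means sum to at least
    [3 w ^ 2 / 256], against correlations of at most [2 w ^ 2 / 256]. The excess [w ^ 2 / 256],
    spread over at most [L ^ 2] pairs, forces a sum of squares of at least [w ^ 6 / 256 ^ 2]. *)
Lemma correlation_lower_bound :
  (256 ^+ 2 * L%:R ^+ 6)^-1 <= \sum_(i < L) \sum_(j < L)
    (integral_co (fun y => tent L i (S y) * tent L j y)
     - integral_co (tent L i : R -> R) * integral_co (tent L j : R -> R)) ^+ 2.
Proof.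
pose D (ij : 'I_L * 'I_L) : R := mean ij.1 * mean ij.2 - corr ij.1 ij.2.
rewrite (pair_bigA _ (fun i j : 'I_L => (corr i j - mean i * mean j) ^+ 2)) /=.
apply: le_trans (_ : \sum_(ij | ij \notin touched) D ij ^+ 2 <= _); last first.
  rewrite [leRHS](bigID (fun ij => ij \in touched))/= -[leLHS]add0r lerD//.
    by apply: sumr_ge0 => ij _; exact: sqr_ge0.
  by apply: ler_sum => ij _; rewrite /D -sqrrN opprB.
have LR : 0 < L%:R :> R by rewrite ltr0n.
have w0 : 0 < w by rewrite invr_gt0.
have Lw : L%:R * w = 1 by rewrite divff// gt_eqF.
pose n : R := (#|[set ij | ij \notin touched]%SET|)%:R.
have nE (c : R) : \sum_(ij : 'I_L * 'I_L | ij \notin touched) c = n * c.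
  by rewrite /n mulr_natl -sumr_const; apply: eq_bigl => ij; rewrite [RHS]inE.
have n_le : n <= L%:R ^+ 2.
  rewrite /n expr2 -natrM ler_nat; apply: leq_trans (max_card _) _.
  by rewrite card_prod card_ord.
have n_ge : 3 / 4 * L%:R ^+ 2 <= n.
  have : (L * L <= #|touched| + #|[set ij | ij \notin touched]%SET|)%N.
    rewrite -{1 2}[L]card_ord -card_prod -(cardC (mem touched)) leq_add2l.
    by rewrite eq_leq//; apply: eq_card => ij; rewrite !inE.
  move=> /leq_trans/(_ (leq_add card_touched (leqnn _))).
  rewrite -(ler_nat R) natrD !natrM -/n.
  have LK : L%:R = 16 * K%:R :> R by rewrite /L natrM.
  have -> : K%:R = L%:R / 16 :> R by rewrite LK; field.
  lra.
have sumD : w ^+ 2 / 256 <= \sum_(ij | ij \notin touched) D ij.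
  rewrite /D sumrB; have := sum_untouched_corr.
  have : n * (w ^+ 2 / 8 * (w ^+ 2 / 8)) <=
      \sum_(ij : 'I_L * 'I_L | ij \notin touched) mean ij.1 * mean ij.2.
    rewrite -nE; apply: ler_sum => ij _.
    have w8 : 0 <= w ^+ 2 / 8 by rewrite mulr_ge0// exprn_ge0// ltW.
    by apply: ler_pM; rewrite ?w8// integral_tent_ge.
  have : 3 / 4 * L%:R ^+ 2 * (w ^+ 2 / 8 * (w ^+ 2 / 8)) <= n * (w ^+ 2 / 8 * (w ^+ 2 / 8)).
    by rewrite ler_wpM2r// !mulr_ge0// ?exprn_ge0// ltW.
  have -> : 3 / 4 * L%:R ^+ 2 * (w ^+ 2 / 8 * (w ^+ 2 / 8)) =
     3 / 256 * (L%:R * w) ^+ 2 * w ^+ 2 by field; rewrite gt_eqF.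
  rewrite Lw; lra.
(* Completing the square at t = w^4 / 256 replaces the Cauchy-Schwarz inequality. *)
pose t : R := w ^+ 4 / 256.
have t0 : 0 <= t.
  by apply: divr_ge0; [rewrite exprn_ge0 ?(ltW w0) | rewrite ler0n].
apply: le_trans (_ : \sum_(ij | ij \notin touched) (2 * t * D ij - t ^+ 2) <= _); last first.
  apply: ler_sum => ij _; have := sqr_ge0 (D ij - t).
  by rewrite sqrrB; lra.
rewrite sumrB nE -mulr_sumr.
have h1 : 2 * t * (w ^+ 2 / 256) <= 2 * t * \sum_(ij | ij \notin touched) D ij.
  by rewrite ler_wpM2l// mulr_ge0.
have h2 : n * t ^+ 2 <= L%:R ^+ 2 * t ^+ 2 by rewrite ler_wpM2r// sqr_ge0.
have h3 : L%:R ^+ 2 * t ^+ 2 = (L%:R * w) ^+ 2 * w ^+ 6 / 256 ^+ 2 by rewrite /t; field; rewrite gt_eqF.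
have h4 : (256 ^+ 2 * L%:R ^+ 6)^-1 = w ^+ 6 / 256 ^+ 2 by rewrite invfM exprVn mulrC.
have h5 : 2 * t * (w ^+ 2 / 256) = 2 * (w ^+ 6 / 256 ^+ 2) by rewrite /t; field; rewrite gt_eqF.
rewrite h4; move: h3; rewrite Lw; lra.
Qed.

End OneTime.

(** * Return times of the exchange and its summed correlations *)

Section IntervalExchangeCorrelations.
Variables (R : realType) (A : finType) (p : iet_perm A) (lam : A -> R).
Variables (u v : A -> int).
Hypothesis lam_simplex : simplex lam.
Hypothesis wedge : wedge_form (top_pos p) (bot_pos p) u v.
Local Notation mR := (measurableTypeR R).
Local Notation mu := (@lebesgue_measure R).
Local Notation T := (iet p lam).
Local Notation top := (top_pos p).
Local Notation U := (lin_form u lam).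
Local Notation V := (lin_form v lam).

(** On [[0, 1)] a single term is nonzero. As a combination of indicators it is measurable and
    integrated letter by letter. *)
Definition return_time (x : R) : nat := \sum_a piece lam top a x * `|u a|%N.

Lemma return_timeE a x : piece lam top a x -> return_time x = `|u a|%N.
Proof.
move=> ax; rewrite /return_time (bigD1 a)//= ax mul1n big1 ?addn0// => b ba.
case: (boolP (piece lam top b x)) => // bx; move/eqP: ba; case.
exact: (piece_inj lam_simplex (top_pos_bij p) bx ax).
Qed.

Lemma return_time_le x : (return_time x <= \sum_a `|u a|)%N.
Proof. by apply: leq_sum => a _; case: piece; rewrite ?mul1n. Qed.

Lemma iet_return x : 0 <= x < 1 -> [/\ 0 <= T x < 1, (0 < return_time x)%N &
  exists l : int, T x = x + (return_time x)%:R * V - l%:~R * U].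
Proof.
move=> x01; have [a ax] := piece_ex lam_simplex (top_pos_bij p) x01.
have u1 := wedge.1 a.
rewrite (return_timeE ax); split; [exact: iet_unit | lia |].
exists (v a); rewrite (iet_translation lam_simplex wedge ax) pmulrn gez0_abs//; lia.
Qed.

Let measurable_iter i : measurable_fun setT (iter i T : mR -> mR).
Proof. exact: measurable_iter_iet. Qed.

Let measurable_iter_piece a i :
  measurable (iter i T @^-1` [set x | piece lam top a x] : set mR).
Proof.
rewrite -[X in measurable X]setTI.
exact: (measurable_iter i measurableT (measurable_piece lam top a)).
Qed.

Lemma bounded_measurable_return_time_iter i :
  bounded_measurable (fun x => (return_time (iter i T x))%:R : R).
Proof.
split; last first.
  exists (\sum_a `|u a|)%:R => x _.
  by rewrite ger0_norm ?ler0n// ler_nat return_time_le.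
rewrite (_ : (fun x => _) = (fun x => \sum_a `|u a|%:R *
   \1_(iter i T @^-1` [set x | piece lam top a x]) x)); last first.
  apply/funext => x; rewrite /return_time natr_sum; apply: eq_bigr => a _.
  rewrite natrM mulrC indicE; congr (_ * _%:R); congr nat_of_bool.
  by apply/idP/idP => [h|]; [rewrite mem_set | rewrite inE].
apply: measurable_sum => a; apply: measurable_funM => //; apply: measurable_indic.
Qed.

Lemma integral_return_time_iter i :
  integral_co (fun x => (return_time (iter i T x))%:R : R) = U.
Proof.
have mP a := measurable_iter_piece a i.
transitivity (integral_co (fun x => \sum_a `|u a|%:R *
   \1_(iter i T @^-1` [set x | piece lam top a x]) x : R)).
  apply: eq_integral_co => x _; rewrite /return_time natr_sum; apply: eq_bigr => a _.
  rewrite natrM mulrC indicE; congr (_ * _%:R); congr nat_of_bool.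
  by apply/idP/idP => [h|]; [rewrite mem_set | rewrite inE].
rewrite integral_co_sum; last first.
  move=> a; apply: bounded_measurableM; first exact: bounded_measurable_cst.
  exact: bounded_measurable_indic.
apply: eq_bigr => a _; rewrite integral_coZ; last exact: bounded_measurable_indic.
rewrite integral_co_indic// (iter_iet_measure_preserving p lam_simplex); last exact: measurable_piece.
have -> : unit_co `&` [set x | piece lam top a x] =
    `[left_end lam top a, left_end lam top a + lam a[%classic.
  apply/seteqP; split=> x /=; rewrite !in_itv /=; first by move=> [].
  by move=> ax; split=> //; exact: (piece_unit lam_simplex (top_pos_bij p) ax).
rewrite lebesgue_measure_itv /= lte_fin ltrDl (lam_simplex.1 a) -EFinB /=.
rewrite [X in _ * X]addrAC subrr add0r; congr (_ * _).
by rewrite pmulrn gez0_abs//; have := wedge.1 a; lia.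
Qed.

Lemma natr_birkhoff n x :
  (birkhoff T return_time n x)%:R = \sum_(i < n) (return_time (iter i T x))%:R :> R.
Proof. by rewrite /birkhoff natr_sum. Qed.

Lemma bounded_measurable_birkhoff n :
  bounded_measurable (fun x => (birkhoff T return_time n x)%:R : R).
Proof.
under eq_fun do rewrite natr_birkhoff.
by apply: bounded_measurable_sum => i; exact: bounded_measurable_return_time_iter.
Qed.

Lemma integral_birkhoff n :
  integral_co (fun x => (birkhoff T return_time n x)%:R : R) = n%:R * U.
Proof.
under eq_integral_co do rewrite natr_birkhoff.
rewrite (@integral_co_sum R _ _ _ (fun (i : 'I_n) x => (return_time (iter i T x))%:R)); last first.
  by move=> i; exact: bounded_measurable_return_time_iter.
under eq_bigr do rewrite integral_return_time_iter.
by rewrite sumr_const card_ord mulr_natl.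
Qed.

Let U1 : 1 <= U. Proof. exact: (simplex_lin_form_ge1 wedge.1 lam_simplex). Qed.

Variable Q : nat -> nat.
Hypothesis QP : forall j, exists m : int, [/\ (0 < Q j <= 2 ^ j)%N,
  coprime (Q j) `|m|%N & `|(Q j)%:R * V - m%:~R * U| <= U / 2 ^+ j].

(** The [n] steps are [n] visits within a time below [2 ^ k]. Multiplying the bound on visits by [U]
    gives the estimate. *)
Lemma birkhoff_ge (N k M n : nat) x : (N * \sum_a `|u a| < 2 ^ k)%N ->
  6 * U * (\sum_(j < k) 2 ^+ j / (Q j)%:R) <= M%:R -> (n <= N)%N -> 0 <= x < 1 ->
  n%:R * U - M%:R <= (birkhoff T return_time n x)%:R.
Proof.
move=> Nk hM nN x01.
have Pk : (birkhoff T return_time n x < 2 ^ k)%N.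
  apply: leq_ltn_trans Nk; apply: leq_trans (leq_mul nN (leqnn _)).
  rewrite /birkhoff -[X in (_ <= X * _)%N]card_ord -sum_nat_const.
  by apply: leq_sum => i _; exact: return_time_le.
have := leq_visits_birkhoff iet_return n x01.
rewrite -(ler_nat R) => /le_trans/(_ (visits_le U1 QP x Pk)).
have U0 : 0 < U := lt_le_trans ltr01 U1.
rewrite -(ler_pM2r U0) mulrDl divfK ?gt_eqF//.
lra.
Qed.

(** The one-time bound holds for every [n < N] with the same [M] and [L]. The signs then turn the
    sum of squared deviations over pairs into deviations of two single functions, which are the same
    for all [n]. *)
Lemma corr_sum_lower_bound (N k M : nat) : (0 < M)%N ->
  (N * \sum_a `|u a| < 2 ^ k)%N ->
  6 * U * (\sum_(j < k) 2 ^+ j / (Q j)%:R) <= M%:R ->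
  let L := (16 * (32 * M + 1))%N in
  exists e e', [/\ is_sign e, is_sign e' &
    N%:R / (256 ^+ 2 * L%:R ^+ 6) <=
    corr_sum T N (tent_comb L e : R -> R) (tent_comb L e')].
Proof.
move=> M0 Nk hM L; have L0 : (0 < L)%N by rewrite /L; lia.
pose a n i j : R := integral_co (fun y => tent L i (iter n T y) * tent L j y)
     - integral_co (tent L i : R -> R) * integral_co (tent L j : R -> R).
have [e [e' [es es' h]]] := exists_signs2 N L a.
exists e, e'; split=> //; apply: le_trans (le_trans h _).
  apply: le_trans (_ : \sum_(n < N) (256 ^+ 2 * L%:R ^+ 6)^-1 <= _).
    by rewrite sumr_const card_ord mulr_natl.
  apply: ler_sum => n _.
  apply: (@correlation_lower_bound R U V (n%:R * U) (iter n T) (birkhoff T return_time n) M).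
  - exact: U1.
  - exact: measurable_iter.
  - by move=> x; exact: (iter_unit iet_return).
  - exact: bounded_measurable_birkhoff.
  - by move=> x; exact: (iter_birkhoff iet_return).
  - by rewrite mulr_ge0// (le_trans ler01 U1).
  - exact: M0.
  - by move=> x; exact: (birkhoff_ge Nk hM (ltnW (ltn_ord n))).
  - exact: integral_birkhoff.
(* What remains is the bilinear expansion of the correlation of two tent combinations. *)
rewrite le_eqVlt; apply/orP; left; apply/eqP; apply: eq_bigr => n _.
have bt i : bounded_measurable (tent L i : R -> R) by exact: bounded_measurable_tent.
have bc (i j : nat) : bounded_measurable (fun y => tent L i (iter n T y) * tent L j y : R).
  apply: bounded_measurableM => //; split.
    exact: (measurableT_comp (f := tent L i : mR -> mR) (@measurable_tent R L i)
      (measurable_iter n)).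
  by exists (L%:R^-1 / 2) => x _; rewrite ger0_norm ?tent_ge0 ?tent_le.
have bcst (c : R) f : bounded_measurable f -> bounded_measurable (fun y => c * f y).
  by move=> bf; apply: bounded_measurableM => //; exact: bounded_measurable_cst.
have Isum e1 : integral_co (tent_comb L e1 : R -> R) =
    \sum_(i < L) e1 i * integral_co (tent L i : R -> R).
  rewrite (@integral_co_sum R _ _ _ (fun (i : 'I_L) x => e1 i * tent L i x)); last first.
    by move=> i; exact: bcst.
  by apply: eq_bigr => i _; rewrite integral_coZ.
have -> : integral_co (fun y => tent_comb L e (iter n T y) * tent_comb L e' y) =
    \sum_(i < L) \sum_(j < L) e i * e' j *
      integral_co (fun y => tent L i (iter n T y) * tent L j y : R).
  transitivity (integral_co (fun y => \sum_(ij : 'I_L * 'I_L)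
      (e ij.1 * e' ij.2) * (tent L ij.1 (iter n T y) * tent L ij.2 y) : R)).
    apply: eq_integral_co => y _; rewrite /tent_comb mulr_suml.
    rewrite -(pair_bigA _ (fun i j : 'I_L =>
      (e i * e' j) * (tent L i (iter n T y) * tent L j y))) /=.
    apply: eq_bigr => i _; rewrite mulr_sumr; apply: eq_bigr => j _; ring.
  rewrite (@integral_co_sum R _ _ _ (fun (ij : 'I_L * 'I_L) y =>
      (e ij.1 * e' ij.2) * (tent L ij.1 (iter n T y) * tent L ij.2 y))); last first.
    by move=> ij; exact: bcst.
  rewrite -(pair_bigA _ (fun i j : 'I_L => integral_co (fun y =>
      (e i * e' j) * (tent L i (iter n T y) * tent L j y)))) /=.
  by apply: eq_bigr => i _; apply: eq_bigr => j _; rewrite integral_coZ.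
rewrite !Isum -[X in _ = X ^+ 2]/(`|_|) real_normK ?num_real//; congr (_ ^+ 2).
rewrite mulr_suml -sumrB; apply: eq_bigr => i _.
rewrite mulr_sumr -sumrB; apply: eq_bigr => j _; rewrite /a; ring.
Qed.

End IntervalExchangeCorrelations.

(** * Logarithmic bounds *)

Section Logarithms.
Variable R : realType.

(** Makes the iterated logarithm positive from [N = 3] on. Numerically, [expR 1] is at most
    [(6/5) ^ 6], which is below 3. *)
Lemma ln3_gt1 : 1 < ln 3 :> R.
Proof.
suff e3 : expR 1 < 3 :> R by rewrite -[ltLHS](@expRK R) ltr_ln ?posrE ?expR_gt0.
have e6 : expR 6^-1 <= 6 / 5 :> R.
  rewrite -[leLHS]invrK -expRN -[leRHS]invrK lef_pV2 ?posrE ?expR_gt0//.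
  by apply: le_trans (expR_ge1Dx _); lra.
have -> : expR 1 = expR 6^-1 ^+ 6 :> R.
  by rewrite -expRM_natl; congr expR; field.
apply: le_lt_trans (_ : (6 / 5) ^+ 6 < _); last by lra.
by rewrite lerXn2r ?nnegrE ?expR_ge0.
Qed.

(** Since [ln N > 1], the additive constants are absorbed into the factor. *)
Lemma trunc_log_le_ln (W : nat) : (0 < W)%N -> exists2 C : R, 0 < C &
  forall N, (3 <= N)%N -> (trunc_log 2 (N * W)).+1%:R <= C * ln N%:R.
Proof.
move=> W0; have a1 := ln3_gt1; set a := ln 3 in a1.
have l2 : 0 < ln 2 :> R by rewrite ln_gt0// ltr1n.
have lW : 0 <= ln W%:R :> R by rewrite ln_ge0// ler1n.
exists (1 + (1 + ln W%:R) / ln 2).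
  by rewrite addr_gt0// divr_gt0//; lra.
move=> N N3; have N0 : (0 < N)%N by lia.
have aN : a <= ln N%:R by rewrite ler_ln ?posrE ?ltr0n// ler_nat.
have NW0 : (0 < N * W)%N by rewrite muln_gt0 N0.
have h : (trunc_log 2 (N * W))%:R * ln 2 <= ln N%:R + ln W%:R :> R.
  rewrite -lnM ?posrE ?ltr0n// mulr_natl -lnXn// ler_ln ?posrE ?exprn_gt0//; last first.
    by rewrite -natrM ltr0n.
  by rewrite -natrX -natrM ler_nat trunc_logP.
rewrite -natr1 mulrDl mul1r addrC lerD//; first lra.
rewrite mulrAC ler_pdivlMr//; apply: le_trans h _.
have : ln W%:R <= ln W%:R * ln N%:R :> R by rewrite ler_peMr//; lra.
rewrite mulrDl; lra.
Qed.

Lemma ln_nat_gt1 (N : nat) : (3 <= N)%N -> 1 < ln N%:R :> R.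
Proof.
move=> N3; apply: lt_le_trans ln3_gt1 _.
by rewrite ler_ln ?posrE ?ltr0n ?ler_nat// (leq_trans _ N3).
Qed.

Lemma powR_lnln_ge (N : nat) (s : R) : 0 <= s -> (3 <= N)%N ->
  ln (ln 3) `^ s <= ln (ln N%:R) `^ s.
Proof.
move=> s0 N3; have l3 := ln3_gt1; have lN := ln_nat_gt1 N3.
apply: (ge0_ler_powR s0); rewrite ?nnegrE ?ln_ge0 ?(ltW l3) ?(ltW lN)//.
have l0 (y : R) : 1 < y -> y \is Num.pos by move=> y1; rewrite posrE (lt_trans ltr01).
rewrite (ler_ln (l0 _ l3) (l0 _ lN)).
by rewrite ler_ln ?posrE ?ltr0n ?ler_nat// (leq_trans _ N3).
Qed.

Lemma cell_count_bounds (M : nat) : (0 < M)%N ->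
  (0 < 16 * (32 * M + 1) <= 528 * M)%N.
Proof. lia. Qed.

(** The origin of the exponent 9: [l] is of order [k] to the power 3/2, and it enters to the power
    6. *)
Lemma cell_count_expr6_le (l r k C C' x : R) : 0 <= l -> 0 <= r -> 0 <= C -> 0 <= k ->
  l <= C * r ^+ 12 -> r ^+ 8 = k -> k <= C' * x ->
  l ^+ 6 <= C ^+ 6 * C' ^+ 9 * x ^+ 9.
Proof.
move=> l0 r0 C0 k0 lC rk kC.
apply: le_trans (_ : (C * r ^+ 12) ^+ 6 <= _).
  by rewrite lerXn2r ?nnegrE// mulr_ge0 ?exprn_ge0.
rewrite exprMn -mulrA -[X in _ <= _ * X]exprMn ler_wpM2l ?exprn_ge0//.
rewrite -exprM -[(12 * 6)%N]/(8 * 9)%N exprM rk lerXn2r ?nnegrE//; exact: le_trans k0 kC.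
Qed.

(** The 81 is the product of the two squared norms, each at most 9. The iterated logarithm [y]
    enters only through its lower bound [rho]. *)
Lemma polylog_bound (n x l y rho b c q C : R) :
  0 <= n -> 0 < x -> 0 < l -> 0 < rho -> rho <= y -> 0 < q -> 0 < C ->
  0 <= b <= 3 -> 0 <= c <= 3 -> l ^+ 6 <= C * x ^+ 9 ->
  rho ^+ 9 / (81 * (q * C)) * (n * b ^+ 2 * c ^+ 2 / (x * y) ^+ 9) <= n / (q * l ^+ 6).
Proof.
move=> n0 x0 l0 rho0 rhoy q0 C0 /andP[b0 b3] /andP[c0 c3] lC.
have sq3 (z : R) : 0 <= z -> z <= 3 -> z ^+ 2 <= 9.
  move=> z0 z3; have -> : 9 = 3 ^+ 2 :> R by ring.
  by rewrite lerXn2r ?nnegrE.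
have num : n * b ^+ 2 * c ^+ 2 <= 81 * n.
  have -> : 81 * n = n * 9 * 9 :> R by ring.
  apply: ler_pM; rewrite ?mulr_ge0 ?sqr_ge0 ?sq3//.
  by rewrite ler_wpM2l ?sq3.
have y0 : 0 < y by exact: lt_le_trans rhoy.
have x9 : 0 < x ^+ 9 by exact: exprn_gt0.
have rho9 : 0 < rho ^+ 9 by exact: exprn_gt0.
have den : x ^+ 9 * rho ^+ 9 <= (x * y) ^+ 9.
  by rewrite exprMn ler_wpM2l ?(ltW x9)// lerXn2r ?nnegrE ?(ltW rho0) ?(ltW y0).
apply: le_trans (_ : rho ^+ 9 / (81 * (q * C)) * (81 * n / (x ^+ 9 * rho ^+ 9)) <= _).
  apply: ler_wpM2l.
    by rewrite ltW// divr_gt0// mulr_gt0 ?ltr0n// mulr_gt0.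
  apply: ler_pM => //; first by rewrite !mulr_ge0 ?sqr_ge0.
    by rewrite invr_ge0 exprn_ge0// mulr_ge0 ?ltW.
  by rewrite lef_pV2 ?posrE ?mulr_gt0// ?exprn_gt0 ?mulr_gt0.
have -> : rho ^+ 9 / (81 * (q * C)) * (81 * n / (x ^+ 9 * rho ^+ 9)) =
    n / (q * (C * x ^+ 9)).
  by field; rewrite ?(gt_eqF x0) ?(gt_eqF rho0) ?(gt_eqF q0) ?(gt_eqF C0).
by rewrite ler_wpM2l// lef_pV2 ?posrE ?mulr_gt0 ?exprn_gt0// ler_wpM2l ?(ltW q0).
Qed.

End Logarithms.

(** * Choice of the constants and conclusion *)

Theorem theorem1p8 (R : realType) (eps : R) (heps : 0 < eps)
    (A : finType) (hA : (1 < #|A|)%N)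
    (p : iet_perm A) (hp : rotation_class p) :
  ae_simplex (fun lam : A -> R =>
    exists2 c2 : R, 0 < c2 &
      forall N : nat, (3 <= N)%N ->
        exists f g : R -> R,
          [/\ [lipschitz (f : R^o -> R^o) x | x in unit_co],
              [lipschitz (g : R^o -> R^o) x | x in unit_co],
              exists2 x, unit_co x & f x != 0,
              exists2 x, unit_co x & g x != 0 &
              c2 * (N%:R * lip_norm f ^+ 2 * lip_norm g ^+ 2
                / (ln N%:R * ln (ln N%:R) `^ (1 + eps)) ^+ 9)
              <= corr_sum (iet p lam) N f g]).
Proof.
have [u [v uvw]] := rotation_class_wedge hp; have [u1 uvE] := uvw.
have [a [b omega_ab]] := irreducible_omega hA hp.1.
have uv_neq0 : exists a b, u a * v b - v a * u b != 0.
  by exists a, b; rewrite -uvE.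
move: (@ae_diophantine R A u v u1 uv_neq0); rewrite /ae_simplex.
apply: negligibleS; apply: subsetC => t dio st.
have [Q [c [QP sumQ]]] := dio st.
set lam := simplex_chart t in st QP *.
set U := lin_form u lam in QP *; set V := lin_form v lam in QP *.
have U1 : 1 <= U by exact: simplex_lin_form_ge1.
(* A bound for all return times, so that Birkhoff sums up to time [N] are at most [N * W]. *)
pose W := (\sum_a `|u a|)%N.
have W0 : (0 < W)%N.
  by rewrite /W (bigD1 a)//= ltn_addr//; have := u1 a; lia.
have [C3 C30 kC3] := @trunc_log_le_ln R W W0.
(* The [+ 1] absorbs the rounding in [M] below, because [r ^+ 12 >= 1]. *)
pose C0 := 6 * U * `|c| + 1.
have C01 : 1 <= C0 by rewrite lerDr !mulr_ge0//; lra.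
have [C1 C10 C1E] : exists2 C1 : R, 0 < C1 & forall x, C1 * x = 528 * (C0 * x).
  exists (528 * C0); last by move=> x; rewrite mulrA.
  by rewrite mulr_gt0 ?ltr0n ?(lt_le_trans ltr01 C01).
pose rho := ln (ln 3) `^ (1 + eps) : R.
have rho0 : 0 < rho by rewrite powR_gt0// ln_gt0// ln3_gt1.
have C0' : 0 < C1 ^+ 6 * C3 ^+ 9 by rewrite mulr_gt0 ?exprn_gt0.
have q0 : 0 < 256 ^+ 2 :> R by rewrite exprn_gt0 ?ltr0n.
exists (rho ^+ 9 / (81 * (256 ^+ 2 * (C1 ^+ 6 * C3 ^+ 9)))).
  apply: divr_gt0; first exact: exprn_gt0.
  by apply: mulr_gt0; [rewrite ltr0n | exact: mulr_gt0].
move=> N N3; pose k := (trunc_log 2 (N * W)).+1.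
have Nk : (N * W < 2 ^ k)%N by exact: trunc_log_ltn.
pose r := rt8 k%:R : R.
have r1 : 1 <= r.
  have <- : rt8 1 = 1 :> R by rewrite /rt8 /rt4 !sqrtr1.
  by rewrite ler_rt8// ler1n.
have r12 : 1 <= r ^+ 12 by rewrite exprn_ege1.
(* An integer just above the discrepancy bound, which is of order [k] to the power 3/2. The
   successor also makes it positive. *)
pose M := (Num.truncn (6 * U * `|c| * r ^+ 12)).+1.
have UC0 : 0 <= 6 * U * `|c| * r ^+ 12.
  by rewrite !mulr_ge0 ?exprn_ge0 ?(le_trans ler01 U1) ?(le_trans ler01 r1).
have /andP[M1 M2] := truncn_itv UC0.
have hM : 6 * U * (\sum_(j < k) 2 ^+ j / (Q j)%:R) <= M%:R.
  apply: le_trans (_ : 6 * U * (`|c| * r ^+ 12) <= _); last by rewrite mulrA ltW.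
  rewrite ler_wpM2l ?mulr_ge0 ?(le_trans ler01 U1)//.
  apply: le_trans (sumQ k) _.
  by rewrite -/r ler_wpM2r ?ler_norm// (le_trans ler01 r12).
have [e [e' [es es' hcorr]]] := corr_sum_lower_bound st uvw QP (ltn0Sn _) Nk hM.
have := cell_count_bounds (ltn0Sn _ : (0 < M)%N).
set L := (16 * (32 * M + 1))%N in hcorr * => /andP[L0 LM].
exists (tent_comb L e), (tent_comb L e'); split.
- exact: tent_comb_lipschitz.
- exact: tent_comb_lipschitz.
- exact: tent_comb_neq0.
- exact: tent_comb_neq0.
apply: le_trans hcorr.
have LC1 : L%:R <= C1 * r ^+ 12.
  move: LM; rewrite -(ler_nat R) natrM => /le_trans; apply.
  rewrite C1E ler_wpM2l ?ler0n// /M -natr1 (mulrDl (6 * U * `|c|) 1) mul1r.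
  by rewrite lerD.
apply: polylog_bound.
- exact: ler0n.
- exact: lt_trans ltr01 (ln_nat_gt1 _ N3).
- by rewrite ltr0n.
- exact: rho0.
- by rewrite powR_lnln_ge// addr_ge0// ltW.
- exact: q0.
- exact: C0'.
- exact: lip_norm_tent_comb.
- exact: lip_norm_tent_comb.
- apply: (cell_count_expr6_le (k := k%:R)) LC1 _ (kC3 N N3) => //.
  + exact: rt8_ge0.
  + exact: ltW.
  + by rewrite rt8K.
Qed.
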